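(* Let $P$ and $Q$ be probabilities on $\mathbb{R}^d$ with means $\mu_1,\mu_2$ and positive definite covariance matrices $\Sigma_1,\Sigma_2$, respectively, and let $\varepsilon>0$. Let $$X_\varepsilon=\Sigma_1^{-1/2}\big(\Sigma_1^{1/2}\Sigma_2\Sigma_1^{1/2}+(\tfrac{\varepsilon}{4})^2 I_d\big)^{1/2}\Sigma_1^{-1/2}-\tfrac{\varepsilon}{4}\Sigma_1^{-1}.$$ Then $$\mathcal{W}^2_{2,\varepsilon}(P,Q)\ge\|\mu_1-\mu_2\|^2+\mathrm{Tr}(\Sigma_1)+\mathrm{Tr}(\Sigma_2)-2\,\mathrm{Tr}(\Sigma_1X_\varepsilon)-\tfrac{\varepsilon}{2}\log\Big((2\pi e)^{2d}\big(\tfrac{\varepsilon}{2}\big)^d\,|\Sigma_1X_\varepsilon|\Big),$$ with equality if and only if $P$ and $Q$ are Gaussian.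
   Context: For probabilities $P,Q$ on $\mathbb{R}^d$, $\Pi(P,Q)$ is the set of probabilities on $\mathbb{R}^d\times\mathbb{R}^d$ with marginals $P$ and $Q$. For a probability $\pi$ on $\mathbb{R}^d\times\mathbb{R}^d$, $H(\pi)=\int r(x,y)\log r(x,y)\,dx\,dy$ if $\pi$ has a Lebesgue density $r$, and $H(\pi)=+\infty$ otherwise. For $\varepsilon>0$, $\mathcal{W}^2_{2,\varepsilon}(P,Q)=\min_{\pi\in\Pi(P,Q)}\big[\int\|x-y\|^2\,d\pi(x,y)+\varepsilon H(\pi)\big]$. $|A|$ denotes the determinant; $A^{1/2}$ is the symmetric positive definite square root; in $(2\pi e)$, $\pi$ is the number $3.14\ldots$. *)

(* Defs.v *)
From HB Require Import structures.
From mathcomp Require Import all_boot all_order all_algebra.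
From mathcomp Require Import all_classical all_reals all_analysis.
Set Implicit Arguments.
Unset Strict Implicit.
Unset Printing Implicit Defensive.
Import Order.TTheory GRing.Theory Num.Theory.
Import numFieldNormedType.Exports.
Local Open Scope classical_set_scope.
Local Open Scope ring_scope.

Definition Rd (R : realType) (d : nat) :=
  g_sigma_algebraType (@open 'rV[R]_d).

Section defs.
Variables (R : realType) (d : nat).
Local Notation T := (Rd R d).
Local Notation disp := (sigma_display (@open 'rV[R]_d)).

Definition box (a b : 'rV[R]_d) : set T :=
  [set x : T | forall i : 'I_d, a 0 i < (x : 'rV[R]_d) 0 i <= b 0 i].

(* lam is the Lebesgue measure on R^d: it gives every box its volume.
   (This determines lam uniquely on the Borel sets.) *)
Definition is_lebesgue (lam : {measure set T -> \bar R}) : Prop :=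
  forall a b : 'rV[R]_d, (forall i, a 0 i <= b 0 i) ->
    lam (box a b) = (\prod_(i < d) (b 0 i - a 0 i))%:E.

Definition is_lebesgue2 (lam2 : {measure set (T * T)%type -> \bar R}) : Prop :=
  forall a b a' b' : 'rV[R]_d,
    (forall i, a 0 i <= b 0 i) -> (forall i, a' 0 i <= b' 0 i) ->
    lam2 (box a b `*` box a' b') =
      (\prod_(i < d) (b 0 i - a 0 i) * \prod_(i < d) (b' 0 i - a' 0 i))%:E.

Definition sqnorm (x : 'rV[R]_d) : R := \sum_(i < d) x 0 i ^+ 2.

(* finite second moments (needed for means and covariances to exist) *)
Definition finite_second_moments (P : probability T R) : Prop :=
  forall i : 'I_d, P.-integrable setT (fun x : T => ((x : 'rV[R]_d) 0 i ^+ 2)%:E).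

Definition mean (P : probability T R) : 'rV[R]_d :=
  \row_i (\int[P]_(x in [set: T]) (x : 'rV[R]_d) 0 i).

Definition cov (P : probability T R) : 'M[R]_d :=
  \matrix_(i, j) (\int[P]_(x in [set: T])
     (((x : 'rV[R]_d) 0 i - mean P 0 i) * ((x : 'rV[R]_d) 0 j - mean P 0 j))).

Definition posdef (A : 'M[R]_d) : Prop :=
  A^T = A /\ forall v : 'rV[R]_d, v != 0 -> 0 < (v *m A *m v^T) 0 0.

(* the symmetric positive definite square root A^{1/2} (of a positive
   definite A; it exists and is unique) *)
Definition sqrtm (A : 'M[R]_d) : 'M[R]_d :=
  xget 0 [set B : 'M[R]_d | posdef B /\ B *m B = A].

Definition gauss_pdf (m : 'rV[R]_d) (S : 'M[R]_d) (x : 'rV[R]_d) : R :=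
  (2 * pi) `^ (- (d%:R / 2)) * (\det S) `^ (- 2^-1) *
  expR (- 2^-1 * (((x - m) *m invmx S *m (x - m)^T) 0 0)).

Definition gaussian (lam : {measure set T -> \bar R}) (P : probability T R) : Prop :=
  exists (m : 'rV[R]_d) (S : 'M[R]_d), posdef S /\
    forall A : set T, measurable A ->
      P A = (\int[lam]_(x in A) (gauss_pdf m S x)%:E)%E.

Definition coupling (P Q : probability T R) (pi0 : probability (T * T)%type R) : Prop :=
  (forall A : set T, measurable A -> pi0 (A `*` setT) = P A) /\
  (forall B : set T, measurable B -> pi0 (setT `*` B) = Q B).

Definition is_density (lam2 : {measure set (T * T)%type -> \bar R})
  (pi0 : probability (T * T)%type R) (r : (T * T)%type -> R) : Prop :=
  measurable_fun setT r /\ (forall z, 0 <= r z) /\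
  forall E : set (T * T)%type, measurable E ->
    pi0 E = (\int[lam2]_(z in E) (r z)%:E)%E.

(* H(pi) = int r log r if pi has a Lebesgue density r, +oo otherwise.
   (Any two densities agree lam2-a.e., so the set below has at most one
   element; the infimum of the empty set is +oo.) *)
Definition entropy (lam2 : {measure set (T * T)%type -> \bar R})
  (pi0 : probability (T * T)%type R) : \bar R :=
  ereal_inf [set v | exists r, is_density lam2 pi0 r /\
      v = (\int[lam2]_(z in [set: (T * T)%type]) (r z * ln (r z))%:E)%E].

Definition cost (pi0 : probability (T * T)%type R) : \bar R :=
  (\int[pi0]_(z in [set: (T * T)%type]) (sqnorm ((z.1 : 'rV[R]_d) - z.2))%:E)%E.

Definition W22eps (lam2 : {measure set (T * T)%type -> \bar R})
  (eps : R) (P Q : probability T R) : \bar R :=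
  ereal_inf [set (cost pi0 + eps%:E * entropy lam2 pi0)%E
             | pi0 in [set pi1 | coupling P Q pi1]].

Definition Xeps (S1 S2 : 'M[R]_d) (eps : R) : 'M[R]_d :=
  invmx (sqrtm S1) *m
    sqrtm (sqrtm S1 *m S2 *m sqrtm S1 + ((eps / 4) ^+ 2)%:M) *m
    invmx (sqrtm S1)
  - (eps / 4) *: invmx S1.

End defs.

(* Main.v *)
(* Put k = eps / 2 and let X = X_eps.  X is the positive definite solution of
   X S1 X + k X = S2, so the density
     q(x, y) = N(mu1, S1)(x) * N(mu2 + (x - mu1) X, k X)(y)
   has marginals N(mu1, S1) and N(mu2, S2), and the mixed quadratic term of
   eps * ln q cancels that of |x - y|^2: the function |x - y|^2 + eps * ln q(x, y)
   is a quadratic polynomial in x plus one in y, whose integral against every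
   coupling of P and Q is the right-hand side.  Hence for a coupling pi the
   objective equals the right-hand side plus eps * KL(pi | q).
   A quantitative form of Gibbs' inequality, uniform in pi, shows that the
   infimum of KL(pi | q) can vanish only if P and Q are the marginals of q; this
   gives the equality case without the existence of a minimiser.  Conversely, if
   P and Q are Gaussian then q itself is the density of a coupling, once it is known
   that the parameters of a Gaussian are its mean and covariance; this follows
   from Gibbs' inequality too, because N(m, S) maximises the expected
   log-likelihood among all Gaussian densities. *)
Require Import Defs.
From HB Require Import structures.
From mathcomp Require Import all_boot all_order all_algebra.
From mathcomp Require Import all_classical all_reals all_analysis.
From mathcomp Require Import measurable_realfun complex ring lra.
Set Implicit Arguments.
Unset Strict Implicit.
Unset Printing Implicit Defensive.
Import Order.TTheory GRing.Theory Num.Theory.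
Import numFieldNormedType.Exports.
Local Open Scope classical_set_scope.
Local Open Scope ring_scope.

(** * Positive definite matrices *)

Section posdef_theory.
Variables (R : realType) (d : nat).
Implicit Types A B C : 'M[R]_d.

(** A nonzero row [v] of the kernel would satisfy [v *m A *m v^T = 0]. *)
Lemma posdef_unitmx A : posdef A -> A \in unitmx.
Proof.
move=> [_ Apos]; rewrite -row_free_unit -kermx_eq0; apply/eqP/row_matrixP => i.
rewrite row0; apply/eqP; apply: contraT => /Apos.
have /sub_kermxP -> : (row i (kermx A) <= kermx A)%MS by exact: row_sub.
by rewrite mul0mx mxE ltxx.
Qed.

Lemma posdef_congr A B : posdef A -> B \in unitmx -> posdef (B *m A *m B^T).
Proof.
move=> [As Apos] Bu; split; first by rewrite !trmx_mul trmxK As mulmxA.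
move=> v v0; have -> : v *m (B *m A *m B^T) *m v^T = (v *m B) *m A *m (v *m B)^T.
  by rewrite trmx_mul !mulmxA.
by apply: Apos; apply: contra v0 => /eqP vB; rewrite -(mulmxK Bu v) vB mul0mx.
Qed.

Lemma posdef_invmx A : posdef A -> posdef (invmx A).
Proof.
move=> Ap; have Au := posdef_unitmx Ap.
have Vu : invmx A \in unitmx by rewrite unitmx_inv.
have := posdef_congr Ap Vu.
by rewrite trmx_inv (proj1 Ap) mulVmx // mul1mx.
Qed.

Lemma posdefD A B : posdef A -> posdef B -> posdef (A + B).
Proof.
move=> [As Ap] [Bs Bp]; split; first by rewrite linearD /= As Bs.
by move=> v v0; rewrite mulmxDr mulmxDl mxE addr_gt0 ?Ap ?Bp.
Qed.

Lemma posdefZ A (c : R) : 0 < c -> posdef A -> posdef (c *: A).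
Proof.
move=> c0 [As Ap]; split; first by rewrite linearZ /= As.
by move=> v v0; rewrite -scalemxAr -scalemxAl mxE mulr_gt0 ?Ap.
Qed.

Lemma mul_row_tr_gt0 (v : 'rV[R]_d) : v != 0 -> 0 < (v *m v^T) 0 0.
Proof.
move=> v0; rewrite mxE lt_neqAle sumr_ge0 ?andbT; last first.
  by move=> i _; rewrite mxE -expr2 sqr_ge0.
rewrite eq_sym psumr_neq0; last by move=> i _; rewrite mxE -expr2 sqr_ge0.
apply/hasP; have [i vi] : exists i, v 0 i != 0.
  by apply/rV0Pn.
by exists i; rewrite ?mem_index_enum // mxE -expr2 exprn_even_gt0.
Qed.

Lemma posdef_scalar_mx (c : R) : 0 < c -> posdef (c%:M : 'M[R]_d).
Proof.
move=> c0; split; first by rewrite tr_scalar_mx.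
by move=> v v0; rewrite mul_mx_scalar -scalemxAl mxE mulr_gt0 ?mul_row_tr_gt0.
Qed.

Lemma posdef_sqr A : A^T = A -> A \in unitmx -> posdef (A *m A).
Proof.
move=> As Au; have := posdef_congr (posdef_scalar_mx ltr01) Au.
by rewrite mulmx1 As.
Qed.

End posdef_theory.

(** Newton's scheme: a new node is fitted by adding a multiple of the polynomial that vanishes at
    the earlier nodes. *)
Lemma poly_interpolation (F : fieldType) (s : seq F) (f : F -> F) :
  exists p : {poly F}, {in s, forall x, p.[x] = f x}.
Proof.
elim: s => [|a s [p ps]]; first by exists 0.
have [as_|nas] := boolP (a \in s).
  by exists p => x; rewrite inE => /predU1P[-> | ]; exact: ps.
pose q := \prod_(b <- s) ('X - b%:P).
have qa : q.[a] != 0 by rewrite -rootE root_prod_XsubC.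
exists (p + ((f a - p.[a]) / q.[a]) *: q) => x; rewrite inE => /predU1P[->|xs].
  by rewrite !hornerE divfK // addrC subrK.
have /rootP qx : root q x by rewrite root_prod_XsubC.
by rewrite !hornerE qx mulr0 addr0 ps.
Qed.

Lemma ReZ (R : realType) (a : R) (z : R[i]) :
  complex.Re (a%:C%C * z) = a * complex.Re z.
Proof. by case: z => x y /=; rewrite mul0r subr0. Qed.

Lemma ImZ (R : realType) (a : R) (z : R[i]) :
  complex.Im (a%:C%C * z) = a * complex.Im z.
Proof. by case: z => x y /=; rewrite mul0r addr0. Qed.

(** This serves to split a complex left eigenvector of a real matrix, for a real eigenvalue, into
    real ones. *)
Lemma map_Re_mulmx (R : realType) m n (u : 'rV[R[i]]_m) (A : 'M[R]_(m, n)) :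
  map_mx (@complex.Re R) (u *m map_mx (real_complex R) A) =
  map_mx (@complex.Re R) u *m A.
Proof.
apply/rowP => j; rewrite !mxE raddf_sum; apply: eq_bigr => k _.
by rewrite !mxE [RHS]mulrC -ReZ [in RHS]mulrC.
Qed.

Lemma map_Im_mulmx (R : realType) m n (u : 'rV[R[i]]_m) (A : 'M[R]_(m, n)) :
  map_mx (@complex.Im R) (u *m map_mx (real_complex R) A) =
  map_mx (@complex.Im R) u *m A.
Proof.
apply/rowP => j; rewrite !mxE raddf_sum; apply: eq_bigr => k _.
by rewrite !mxE [RHS]mulrC -ImZ [in RHS]mulrC.
Qed.

Lemma horner_mx_conj_diag (F : fieldType) n (P : 'M[F]_n.+1) (v : 'rV[F]_n.+1)
    (p : {poly F}) : P \in unitmx ->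
  horner_mx (invmx P *m diag_mx v *m P) p =
  invmx P *m diag_mx (map_mx (horner p) v) *m P.
Proof.
move=> Pu; have Vu : invmx P \in unitmx by rewrite unitmx_inv.
have -> : invmx P *m diag_mx v *m P = conjmx (invmx P) (diag_mx v).
  by rewrite conjumx // invmxK.
rewrite -horner_mx_diag horner_mx_conj ?row_free_unit //; last exact: stablemx_unit.
by rewrite conjumx // invmxK.
Qed.

Lemma horner_mx_fourth_root (F : fieldType) n (A P : 'M[F]_n.+1) (v : 'rV[F]_n.+1)
    (p : {poly F}) : P \in unitmx -> A = invmx P *m diag_mx v *m P ->
  (forall i, p.[v 0 i] ^+ 4 = v 0 i) ->
  horner_mx A p *m horner_mx A p *m (horner_mx A p *m horner_mx A p) = A.
Proof.
move=> Pu AE pv; have sq (D E : 'M[F]_n.+1) :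
    (invmx P *m D *m P) *m (invmx P *m E *m P) = invmx P *m (D *m E) *m P.
  by rewrite !mulmxA mulmxK.
rewrite [in RHS]AE AE horner_mx_conj_diag // !sq !mulmx_diag.
congr (_ *m diag_mx _ *m _).
by apply/rowP => i; rewrite !mxE -!expr2 -exprM.
Qed.

(* Diagonalise A over the complex numbers and interpolate the fourth root at its
   eigenvalues, which are real, by a real polynomial p: then p(A) is real,
   symmetric and in the bicommutant of A.  Its square is the positive definite
   square root of A. *)
Lemma posdef_fourth_root (R : realType) d (A : 'M[R]_d) : posdef A ->
  exists B : 'M[R]_d, [/\ B^T = B, B *m B *m (B *m B) = A &
    forall C, C *m A = A *m C -> C *m B = B *m C].
Proof.
case: d A => [|d] A Ap.
  by exists 0; split => [||C _]; apply/matrixP => - [].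
have [As Apos] := Ap.
pose AC : 'M[R[i]]_d.+1 := map_mx (real_complex R) A.
have ACsym : AC^T = AC by rewrite /AC map_trmx As.
have ACreal : AC \is a mxOver Num.real.
  by apply/mxOverP => i j; rewrite mxE; apply/complex_realP; exists (A i j).
have ACherm : AC \is hermsymmx.
  apply: realsym_hermsym => //; apply/is_hermitianmxP.
  by rewrite expr0 scale1r map_mx_id // ACsym.
have sp_real := hermitian_spectral_diag_real ACherm.
have /orthomx_spectralP := hermitian_normalmx ACherm.
have Pu := spectral_unit AC.
set P := spectralmx AC in Pu *; set sp := spectral_diag AC in sp_real * => ACE.
have spE i : exists k : R, sp 0 i = k%:C%C.
  by apply/complex_realP; move/mxOverP: sp_real; apply.
pose l i := complex.Re (sp 0 i).
have {}spE i : sp 0 i = (l i)%:C%C.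
  by rewrite /l; have [k ->] := spE i.
(* Row [i] of [P] is a complex left eigenvector for the real eigenvalue [l i]. Its real and
   imaginary parts are eigenvectors of [A], one of them is nonzero, and positivity of [A] is applied
   to that one. *)
have l0 i : 0 < l i.
  have PAE : row i P *m AC = sp 0 i *: row i P.
    rewrite [in LHS]ACE !mulmxA -row_mul mulmxV // -row_mul mul1mx.
    by rewrite row_diag_mx -scalemxAl -rowE.
  have rP0 : row i P != 0.
    apply: contraTneq Pu => rP0; rewrite -row_free_unit; apply/negP => /row_freeP[Q].
    move=> /(congr1 (row i)); rewrite row_mul rP0 mul0mx => /rowP /(_ i).
    by rewrite !mxE eqxx => /eqP; rewrite eq_sym oner_eq0.
  pose x := map_mx (@complex.Re R) (row i P).
  pose y := map_mx (@complex.Im R) (row i P).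
  have xE : x *m A = l i *: x.
    have := congr1 (map_mx (@complex.Re R)) PAE; rewrite spE.
    by rewrite map_Re_mulmx => ->; apply/rowP => j; rewrite !mxE ReZ.
  have yE : y *m A = l i *: y.
    have := congr1 (map_mx (@complex.Im R)) PAE; rewrite spE.
    by rewrite map_Im_mulmx => ->; apply/rowP => j; rewrite !mxE ImZ.
  have eigen_gt0 (v : 'rV[R]_d.+1) : v != 0 -> v *m A = l i *: v -> 0 < l i.
    move=> v0 vE; have := Apos _ v0; rewrite vE -scalemxAl mxE.
    by rewrite pmulr_lgt0 ?mul_row_tr_gt0.
  have [x0|x0] := eqVneq x 0; last exact: (eigen_gt0 _ x0).
  have [y0|y0] := eqVneq y 0; last exact: (eigen_gt0 _ y0).
  case/eqP: rP0; apply/rowP => j; rewrite [in RHS]mxE.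
  have /rowP/(_ j) := x0; have /rowP/(_ j) := y0; rewrite !mxE.
  by case: (P i j) => a b /= -> ->.
have [p pE] := poly_interpolation [seq l i | i <- enum 'I_d.+1]
  (fun x => Num.sqrt (Num.sqrt x)).
have {}pE i : p.[l i] = Num.sqrt (Num.sqrt (l i)).
  by apply: pE; rewrite map_f // mem_enum.
exists (horner_mx A p); split.
- elim/poly_ind: (p) => [|q c IH]; first by rewrite rmorph0 trmx0.
  rewrite rmorphD rmorphM /= horner_mx_X horner_mx_C linearD /= tr_scalar_mx.
  rewrite trmx_mul IH As; congr (_ + _).
  exact: (comm_mx_horner q (comm_mx_refl A)).
(* The identity is checked over the complex numbers, where [A] is diagonalised, and descends by
   injectivity of the embedding. *)
- apply: (map_mx_inj (f := real_complex R)).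
  rewrite !map_mxM map_horner_mx -/AC.
  apply: (horner_mx_fourth_root Pu ACE) => i.
  rewrite spE horner_map /= pE -rmorphXn /=; congr (_%:C)%C.
  by rewrite (exprM _ 2 2) sqr_sqrtr ?sqrtr_ge0 // sqr_sqrtr // ltW.
- by move=> C CA; apply/esym; apply: comm_horner_mx.
Qed.

(** The root is the square of a symmetric fourth root [B]: symmetry and invertibility of [B] alone
    make [B *m B] positive definite. *)
Lemma posdef_sqrt (R : realType) d (A : 'M[R]_d) : posdef A ->
  exists B : 'M[R]_d, [/\ posdef B, B *m B = A &
    forall C, C *m A = A *m C -> C *m B = B *m C].
Proof.
move=> Ap; have [B [Bs BE Bc]] := posdef_fourth_root Ap.
exists (B *m B); split => // [|C CA].
  apply: posdef_sqr => //; have := posdef_unitmx Ap.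
  by rewrite -BE !unitmx_mul => /andP[/andP[]].
by rewrite mulmxA (Bc _ CA) -!mulmxA (Bc _ CA).
Qed.

(** The determinant is the square of that of an invertible square root. *)
Lemma posdef_det_gt0 (R : realType) d (A : 'M[R]_d) : posdef A -> 0 < \det A.
Proof.
move=> Ap; have [B [Bp <- _]] := posdef_sqrt Ap.
rewrite det_mulmx -expr2 exprn_even_gt0 //=.
by have := posdef_unitmx Bp; rewrite unitmxE unitfE.
Qed.

Lemma invmx_mul (F : fieldType) n (A B : 'M[F]_n) :
  A \in unitmx -> B \in unitmx -> invmx (A *m B) = invmx B *m invmx A.
Proof.
move=> Au Bu; have ABu : A *m B \in unitmx by rewrite unitmx_mul Au.
apply: (can_inj (mulmxK ABu)); rewrite mulVmx // -mulmxA (mulmxA _ A) mulVmx //.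
by rewrite mul1mx mulVmx.
Qed.

(** * The Riccati equation satisfied by X_eps *)

Section riccati.
Variables (R : realType) (d : nat).
Implicit Types A B C D S X : 'M[R]_d.

(* E = (D + c)^{1/2} commutes with D, so D - c = E^{-1} N E^{-1}. *)
Lemma posdef_sqrt_shift D N (c : R) : posdef D -> posdef N -> 0 < c ->
  D *m D = N + (c ^+ 2)%:M -> posdef (D - c%:M).
Proof.
move=> Dp Np c0 DE.
have [E [Ep EE Ec]] := posdef_sqrt (posdefD Dp (posdef_scalar_mx d c0)).
have Eu := posdef_unitmx Ep.
have ED : D *m E = E *m D.
  by apply: Ec; rewrite mulmxDl mulmxDr scalar_mxC.
have EN : E *m (D - c%:M) *m E = N.
  have <- : (D - c%:M) *m E = E *m (D - c%:M).
    by rewrite mulmxBl mulmxBr ED scalar_mxC.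
  rewrite -mulmxA EE mulmxDr !mulmxBl DE scalar_mxC -scalar_mxM -expr2.
  by rewrite addrA subrK addrK.
have := posdef_congr Np (_ : invmx E \in unitmx).
rewrite unitmx_inv => /(_ Eu); rewrite trmx_inv (proj1 Ep).
by rewrite -EN !mulmxA mulVmx // mul1mx mulmxK.
Qed.

(** With [G = invmx r], [X = G (D - c) G], so the left side is [G (D - c + 2c) (D - c) G = G (D^2 -
    c^2) G], and [D^2 - c^2] is [r S2 r]. *)
Lemma riccati_root S1 S2 r D (c : R) :
  posdef S2 -> posdef r -> r *m r = S1 -> posdef D -> 0 < c ->
  D *m D = r *m S2 *m r + (c ^+ 2)%:M ->
  let X := invmx r *m D *m invmx r - c *: invmx S1 in
  posdef X /\ X *m S1 *m X + (2 * c) *: X = S2.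
Proof.
move=> S2p rp rE Dp c0 DE; have ru := posdef_unitmx rp.
have -> : invmx r *m D *m invmx r - c *: invmx S1 =
    invmx r *m (D - c%:M) *m invmx r.
  by rewrite -rE invmx_mul // mulmxBr mulmxBl mul_mx_scalar -scalemxAl.
have ruT : invmx r \in unitmx by rewrite unitmx_inv.
split.
  have Np : posdef (r *m S2 *m r) by have := posdef_congr S2p ru; rewrite (proj1 rp).
  have := posdef_congr (posdef_sqrt_shift Dp Np c0 DE) ruT.
  by rewrite trmx_inv (proj1 rp).
rewrite -rE !mulmxA mulmxKV // mulmxK //.
rewrite -[_ *m (D - _) *m (D - _)]mulmxA scalemxAl scalemxAr -mulmxDl -mulmxDr.
rewrite -mul_scalar_mx -mulmxDl.
have -> : (D - c%:M + (2 * c)%:M) *m (D - c%:M) = r *m S2 *m r.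
  have -> : D - c%:M + (2 * c)%:M = D + c%:M.
    by rewrite mulr_natl mulr2n raddfD /= addrA subrK.
  rewrite mulmxBr !mulmxDl DE scalar_mxC -scalar_mxM -expr2 opprD addrA.
  by rewrite !addrK.
by rewrite !mulmxA mulVmx // mul1mx mulmxK.
Qed.

(* Y is the regression matrix of x on y, as X is that of y on x. *)
Lemma riccati_dual S1 S2 X (k : R) :
  posdef S1 -> posdef S2 -> posdef X -> 0 < k -> X *m S1 *m X + k *: X = S2 ->
  let Y := invmx (X + k *: invmx S1) in
  [/\ posdef Y, invmx X = Y + k *: invmx S2 & \det S1 * \det X = \det S2 * \det Y].
Proof.
move=> S1p S2p Xp k0 E.
have Zp := posdefD Xp (posdefZ k0 (posdef_invmx S1p)).
have [[S1u Xu] Zu] := (posdef_unitmx S1p, posdef_unitmx Xp, posdef_unitmx Zp).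
set Z := X + k *: _ in Zp Zu *; move=> Y.
(* This factorisation of [S2] yields both the formula for [invmx X] and the determinant identity. *)
have S2E : S2 = X *m S1 *m Z.
  by rewrite -E /Z mulmxDr -scalemxAr mulmxK.
have detZ : \det Z * \det Y = 1 by rewrite -det_mulmx mulmxV // det1.
split; first exact: posdef_invmx.
  have -> : invmx S2 = Y *m (invmx S1 *m invmx X).
    by rewrite S2E invmx_mul ?unitmx_mul ?Xu // invmx_mul.
  rewrite scalemxAr scalemxAl -[X in X + _]mulmx1 -(mulmxV Xu) -mulmxDr -mulmxDl.
  by rewrite mulmxA mulVmx // mul1mx.
by rewrite S2E !det_mulmx -[RHS]mulrA detZ mulr1 mulrC.
Qed.

(** Multiplying the equation by [invmx X] on the left gives [S1 X + k I]. *)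
Lemma riccati_trace S1 S2 X (k : R) :
  posdef X -> X *m S1 *m X + k *: X = S2 ->
  \tr (invmx X *m S2) = \tr (S1 *m X) + k * d%:R.
Proof.
move=> /posdef_unitmx Xu <-; rewrite mulmxDr -scalemxAr mulVmx // -mulmxA mulKmx //.
by rewrite mxtraceD mxtraceZ mxtrace1.
Qed.

End riccati.

(** * Schur complement of the first coordinate *)

Section schur_complement.
Variables (R : realType) (n : nat) (L : 'M[R]_(1 + n)).
Hypothesis Lpos : posdef L.

Definition pivot : R := L 0 0.
Definition schur : 'M[R]_n :=
  drsubmx L - pivot^-1 *: ((ursubmx L)^T *m ursubmx L).

Lemma pivot_gt0 : 0 < pivot.
Proof.
have := proj2 Lpos (delta_mx 0 0); rewrite -rowE trmx_delta -colE !mxE.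
apply; apply/eqP => /rowP/(_ 0); rewrite !mxE !eqxx => /eqP.
by rewrite oner_eq0.
Qed.

Lemma ulsubmx_pivot : ulsubmx L = pivot%:M.
Proof. by apply/matrixP => i j; rewrite !ord1 !mxE mulr1n; congr (L _ _); apply/val_inj. Qed.

Lemma posdef_blockE :
  L = block_mx pivot%:M (ursubmx L) (ursubmx L)^T (drsubmx L).
Proof.
rewrite -[LHS]submxK ulsubmx_pivot; congr block_mx.
by rewrite trmx_ursub (proj1 Lpos).
Qed.

(** One step of block Gaussian elimination: unipotent lower factor times block upper triangular
    factor. *)
Lemma det_schur : \det L = pivot * \det schur.
Proof.
have -> : L = block_mx 1%:M 0 (pivot^-1 *: (ursubmx L)^T) 1%:M *m
              block_mx pivot%:M (ursubmx L) 0 schur.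
  rewrite mulmx_block !mul1mx !mul0mx !addr0 {1}posdef_blockE; congr block_mx.
    by rewrite mul_mx_scalar scalerA divff ?scale1r // gt_eqF // pivot_gt0.
  by rewrite -scalemxAl addrC subrK.
by rewrite det_mulmx det_lblock det_ublock !det1 !mul1r det_scalar1.
Qed.

(** Completing the square in the first coordinate; this is what lets a Gaussian integral be computed
    one coordinate at a time. *)
Lemma schur_quad (x : R) (y : 'rV[R]_n) :
  (row_mx x%:M y *m L *m (row_mx x%:M y)^T) 0 0 =
  pivot * (x + pivot^-1 * (y *m (ursubmx L)^T) 0 0) ^+ 2 + (y *m schur *m y^T) 0 0.
Proof.
have p0 := pivot_gt0.
rewrite {1}posdef_blockE mul_row_block tr_row_mx mul_row_col tr_scalar_mx.
rewrite mul_mx_scalar !mul_scalar_mx scale_scalar_mx.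
rewrite mulmxDl -scalemxAl /schur mulmxBr mulmxBl -scalemxAr -scalemxAl mulmxA.
rewrite -(mulmxA _ (ursubmx L) y^T).
have -> : ursubmx L *m y^T = (y *m (ursubmx L)^T)^T by rewrite trmx_mul trmxK.
set u := y *m (ursubmx L)^T; set C := y *m drsubmx L *m y^T.
have uuE : (u *m u^T) 0 0 = u 0 0 * u 0 0 by rewrite mxE big_ord1 [u^T _ _]mxE.
have eltD (A B : 'M[R]_1) : (A + B) 0 0 = A 0 0 + B 0 0 by rewrite mxE.
have eltN (A : 'M[R]_1) : (- A) 0 0 = - A 0 0 by rewrite mxE.
have eltZ c (A : 'M[R]_1) : (c *: A) 0 0 = c * A 0 0 by rewrite mxE.
have eltC c : (c%:M : 'M[R]_1) 0 0 = c by rewrite mxE.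
have eltT (A : 'M[R]_1) : A^T 0 0 = A 0 0 by rewrite mxE.
rewrite !(eltD, eltN, eltZ, eltC, eltT) uuE; field.
by rewrite gt_eqF.
Qed.

Lemma posdef_schur : posdef schur.
Proof.
split.
  rewrite /schur linearB linearZ /= trmx_mul trmxK; congr (_ - _).
  by rewrite trmx_drsub (proj1 Lpos).
(* This first coordinate makes the completed square vanish, leaving only the form of [schur]. *)
move=> y y0; pose x := - (pivot^-1 * (y *m (ursubmx L)^T) 0 0).
have := proj2 Lpos (row_mx x%:M y).
rewrite schur_quad /x addNr expr0n /= mulr0 add0r; apply.
apply: contra y0 => /eqP; rewrite -row_mx0 => /eq_row_mx[_ ->].
exact: eqxx.
Qed.

End schur_complement.

Lemma sqrtmP (R : realType) d (A : 'M[R]_d) : posdef A ->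
  posdef (sqrtm A) /\ sqrtm A *m sqrtm A = A.
Proof.
move=> Ap; have [B [Bp BE _]] := posdef_sqrt Ap.
by apply: (@xgetPex _ 0 [set B | posdef B /\ B *m B = A]); exists B.
Qed.

(** The instance [c = eps / 4] of [riccati_root], whose linear coefficient [2 * c] is [eps / 2]. *)
Lemma Xeps_riccati (R : realType) d (S1 S2 : 'M[R]_d) (eps : R) :
  posdef S1 -> posdef S2 -> 0 < eps ->
  posdef (Xeps S1 S2 eps) /\
  Xeps S1 S2 eps *m S1 *m Xeps S1 S2 eps + (eps / 2) *: Xeps S1 S2 eps = S2.
Proof.
move=> S1p S2p e0; have c0 : 0 < eps / 4 by rewrite divr_gt0.
have [rp rE] := sqrtmP S1p; have ru := posdef_unitmx rp.
have Np : posdef (sqrtm S1 *m S2 *m sqrtm S1 + ((eps / 4) ^+ 2)%:M).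
  apply: posdefD; last by apply: posdef_scalar_mx; rewrite exprn_gt0.
  by have := posdef_congr S2p ru; rewrite (proj1 rp).
have [Dp DE] := sqrtmP Np.
have -> : eps / 2 = 2 * (eps / 4) by field.
exact: (riccati_root S2p rp rE Dp c0 DE).
Qed.

(** * Lebesgue measure on R^d *)

Section borel_Rd.
Variables (R : realType) (d : nat).
Local Notation T := (Rd R d).

Lemma measurable_open_Rd (U : set 'rV[R]_d) :
  open U -> measurable (U : set T).
Proof. by move=> oU; apply: sub_sigma_algebra. Qed.

Lemma measurable_coord (i : 'I_d) :
  measurable_fun [set: T] (fun x : T => (x : 'rV[R]_d) 0 i).
Proof.
apply: (measurability _ (RGenOpens.measurableE R)) => _ [_ [a [b ->] <-]].
rewrite setTI; apply: measurable_open_Rd.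
have /continuousP := @coord_continuous R 1 d 0 i; apply.
exact: interval_open.
Qed.

Lemma boxE (a b : 'rV[R]_d) : box a b =
  \bigcap_(i in [set: 'I_d])
    (fun x : T => (x : 'rV[R]_d) 0 i) @^-1` [set` `]a 0 i, b 0 i]].
Proof.
apply/seteqP; split => x /= h i; first by move=> _ /=; rewrite in_itv /= h.
by have := h i Logic.I; rewrite /= in_itv.
Qed.

Lemma measurable_box (a b : 'rV[R]_d) : measurable (box a b).
Proof.
rewrite boxE; apply: fin_bigcap_measurable => [|i _]; first exact: finite_finset.
by rewrite -[X in measurable X]setTI; apply: measurable_coord.
Qed.

Lemma boxI (a b a' b' : 'rV[R]_d) : box a b `&` box a' b' =
  box (\row_i Num.max (a 0 i) (a' 0 i)) (\row_i Num.min (b 0 i) (b' 0 i)).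
Proof.
apply/seteqP; split => [x [h h'] i|x h].
  have /andP[h1 h2] := h i; have /andP[h3 h4] := h' i.
  by rewrite !mxE gt_max le_min; apply/andP; split; apply/andP.
by split => i; have := h i; rewrite !mxE gt_max le_min;
  move=> /andP[/andP[h1 h2] /andP[h3 h4]]; apply/andP.
Qed.

Definition boxes : set (set T) := [set box a b | a in setT & b in setT].

Lemma boxes_setI_closed : setI_closed boxes.
Proof.
move=> _ _ [a _ [b _ <-]] [a' _ [b' _ <-]]; rewrite boxI.
by eexists => //; eexists.
Qed.

Local Notation ratrow := (map_mx (@ratr R)).

(** Rational corners make the union countable, so that the half-open boxes generate the Borel
    sets. *)
Lemma open_bigcup_box (U : set 'rV[R]_d) : open U -> (U : set T) =
  \bigcup_(p in [set p : 'rV[rat]_d * 'rV[rat]_d |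
      box (ratrow p.1) (ratrow p.2) `<=` U]) box (ratrow p.1) (ratrow p.2).
Proof.
move=> oU; apply/seteqP; split => [x Ux|x [p /= sub /sub//]].
have /nbhs_ballP[e /= e0 sub] := open_nbhs_nbhs (conj oU Ux).
pose y : 'rV[R]_d := x.
(* The lower corner is strictly below the point and the upper one weakly above, as membership in a
   half-open box requires; balls are those of the sup norm, so each coordinate is treated alone. *)
have /choice[q qE] (i : 'I_d) : exists q : rat * rat,
    [/\ y 0 i - e < ratr q.1, ratr q.1 < y 0 i, y 0 i <= ratr q.2 & ratr q.2 < y 0 i + e].
  have /rat_in_itvoo[q1] : y 0 i - e < y 0 i by rewrite ltrBlDr ltrDl.
  have /rat_in_itvoo[q2] : y 0 i < y 0 i + e by rewrite ltrDl.
  rewrite !in_itv /= => /andP[h1 h2] /andP[h3 h4].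
  by exists (q1, q2); split => //; exact: ltW.
exists (\row_i (q i).1, \row_i (q i).2) => [z zb|i]; last first.
  by rewrite !mxE; have [_ -> -> _] := qE i.
apply: sub; split => // i j; rewrite (ord1 i) /ball /= ltr_distlC.
have := zb j; rewrite !mxE => /andP[h1 h2]; have [h3 h4 h5 h6] := qE j.
by rewrite (lt_trans h3 h1) (le_lt_trans h2 h6).
Qed.

Lemma measurable_Rd_boxes : @measurable _ T = <<s boxes >>.
Proof.
apply/seteqP; split; last first.
  apply: smallest_sub; first exact: sigma_algebra_measurable.
  by move=> _ [a _ [b _ <-]]; exact: measurable_box.
apply: smallest_sub; first exact: smallest_sigma_algebra.
move=> U /open_bigcup_box ->; rewrite bigcup_mkcond.
apply: (@countable_bigcupT_measurable _ (g_sigma_algebraType boxes)).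
  exact: countableP.
move=> p; case: ifPn => _; last exact: (@measurable0 _ (g_sigma_algebraType boxes)).
by apply: sub_sigma_algebra; exists (ratrow p.1) => //; exists (ratrow p.2).
Qed.

Lemma measurable_fun_Rd d' (T' : measurableType d') (f : T' -> T) :
  (forall i, measurable_fun setT (fun t => (f t : 'rV[R]_d) 0 i)) ->
  measurable_fun setT f.
Proof.
move=> mf; apply: (measurability _ measurable_Rd_boxes) => _ [_ [a _ [b _ <-]] <-].
rewrite setTI boxE preimage_bigcap.
apply: fin_bigcap_measurable => [|i _]; first exact: finite_finset.
by rewrite -[X in measurable X]setTI; apply: mf.
Qed.

Definition cube (k : nat) : set T := box (const_mx (- k%:R)) (const_mx k%:R).

Lemma bigcup_cube : \bigcup_k cube k = setT.
Proof.
apply/seteqP; split => // x _; pose y : 'rV[R]_d := x.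
pose M := \sum_i `|y 0 i|.
exists (Num.truncn M).+1 => // i; rewrite !mxE.
have yM : `|y 0 i| < (Num.truncn M).+1%:R.
  rewrite (le_lt_trans _ (truncnS_gt _)) // /M (bigD1 i) //= lerDl.
  exact: sumr_ge0.
have /andP[-> h] : - (Num.truncn M).+1%:R < y 0 i < (Num.truncn M).+1%:R by rewrite -ltr_norml.
exact: ltW.
Qed.

(** [is_lebesgue] prescribes volumes only for ordered corners; this covers the remaining boxes. *)
Lemma box_eq0 (a b : 'rV[R]_d) : (forall i, a 0 i <= b 0 i) \/ box a b = set0.
Proof.
have [ab|/existsNP[i /negP]] := pselect (forall i, a 0 i <= b 0 i); first by left.
rewrite -ltNge => ba; right; apply/seteqP; split => // x /(_ i).
by move=> /andP[h1 h2]; have := lt_le_trans h1 h2; rewrite ltNge (ltW ba).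
Qed.

Lemma lebesgue_cube_fin (lam : {measure set T -> \bar R}) k :
  is_lebesgue lam -> (lam (cube k) < +oo)%E.
Proof.
move=> ->; first by rewrite ltry.
by move=> i; rewrite !mxE (@le_trans _ _ 0) // oppr_le0.
Qed.

Lemma lebesgue_sigma_finite (lam : {measure set T -> \bar R}) :
  is_lebesgue lam -> sigma_finite setT lam.
Proof.
move=> lamE; exists cube; first by rewrite bigcup_cube.
by move=> k; split; [exact: measurable_box|exact: lebesgue_cube_fin].
Qed.

(** Boxes are stable under intersection and generate the Borel sets, and the cubes exhaust the space
    with finite measure. *)
Lemma eq_measure_boxes (m1 m2 : {measure set T -> \bar R}) :
  (forall a b, m1 (box a b) = m2 (box a b)) -> (forall k, m1 (cube k) < +oo)%E ->
  forall A, measurable A -> m1 A = m2 A.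
Proof.
move=> m12 m1fin A mA; apply: (measure_unique boxes cube) => //.
- exact: measurable_Rd_boxes.
- exact: boxes_setI_closed.
- by move=> k; eexists => //; eexists.
- exact: bigcup_cube.
- by move=> _ [a _ [b _ <-]]; exact: m12.
Qed.

Lemma lebesgue_unique (lam lam' : {measure set T -> \bar R}) :
  is_lebesgue lam -> is_lebesgue lam' ->
  forall A, measurable A -> lam A = lam' A.
Proof.
move=> lamE lamE'; apply: eq_measure_boxes => [a b|k]; last exact: lebesgue_cube_fin.
by have [ab|->] := box_eq0 a b; rewrite ?measure0 // lamE // lamE'.
Qed.

End borel_Rd.

(** * Lebesgue measure on the product space *)

Section lebesgue_product.
Variables (R : realType) (d : nat).
Local Notation T := (Rd R d).
Local Open Scope ereal_scope.

Definition boxes2 : set (set (T * T)) :=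
  [set A `*` B | A in @boxes R d & B in @boxes R d].

Lemma measurable_boxes (A : set T) : boxes A -> measurable A.
Proof. by move=> [a _ [b _ <-]]; exact: measurable_box. Qed.

Lemma boxes_cube k : boxes (@cube R d k).
Proof. by eexists => //; eexists. Qed.

(** A strip is a countable union of products of its base with cubes. *)
Lemma boxes2_sigma (A : set T) : boxes A ->
  <<s boxes2 >> (A `*` setT) /\ <<s boxes2 >> (setT `*` A).
Proof.
move=> bA; have -> : A `*` setT = \bigcup_k (A `*` @cube R d k).
  rewrite -(@bigcup_cube R d); apply/seteqP.
  by split => [[x y] [/= Ax [k _ yk]]|[x y] [k _ [/= Ax yk]]];
    [exists k|split => //; exists k].
have -> : setT `*` A = \bigcup_k (@cube R d k `*` A).
  rewrite -(@bigcup_cube R d); apply/seteqP.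
  by split => [[x y] [/= [k _ xk] Ay]|[x y] [k _ [/= xk Ay]]];
    [exists k|split => //; exists k].
split; apply: sigma_algebra_bigcup => k; apply: sub_sigma_algebra.
  by exists A => //; exists (cube k) => //; exact: boxes_cube.
by exists (cube k); [exact: boxes_cube|exists A].
Qed.

Lemma measurable_prod_boxes2 : @measurable _ (T * T)%type = <<s boxes2 >>.
Proof.
apply/seteqP; split; last first.
  apply: smallest_sub; first exact: sigma_algebra_measurable.
  by move=> _ [A /measurable_boxes mA [B /measurable_boxes mB <-]]; exact: measurableX.
pose G := g_sigma_algebraType boxes2.
have mfst : measurable_fun [set: G] (fst : G -> T).
  apply: (measurability _ (@measurable_Rd_boxes R d)) => _ [A /boxes2_sigma[bA _] <-].
  by rewrite setTI; move: bA; rewrite setXT.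
have msnd : measurable_fun [set: G] (snd : G -> T).
  apply: (measurability _ (@measurable_Rd_boxes R d)) => _ [A /boxes2_sigma[_ bA] <-].
  by rewrite setTI; move: bA; rewrite setTX.
apply: smallest_sub; first exact: smallest_sigma_algebra.
by move=> _ [[A mA <-]|[A mA <-]]; [exact: mfst|exact: msnd].
Qed.

Lemma boxes2_setI_closed : setI_closed boxes2.
Proof.
move=> _ _ [A bA [B bB <-]] [A' bA' [B' bB' <-]]; rewrite -setXI.
exists (A `&` A'); first exact: boxes_setI_closed.
by exists (B `&` B') => //; exact: boxes_setI_closed.
Qed.

Lemma bigcup_cube2 : \bigcup_k (@cube R d k `*` @cube R d k) = setT.
Proof.
have cubeS k l : (k <= l)%N -> @cube R d k `<=` cube l.
  move=> kl x xk i; have := xk i; rewrite !mxE => /andP[h1 h2].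
  rewrite (le_lt_trans _ h1) ?(le_trans h2) ?ler_nat //.
  by rewrite lerN2 ler_nat.
apply/seteqP; split => // -[x y] _.
have [k _ xk] : (\bigcup_k @cube R d k) x by rewrite bigcup_cube.
have [l _ yl] : (\bigcup_k @cube R d k) y by rewrite bigcup_cube.
exists (maxn k l) => //; split; [apply: cubeS xk|apply: cubeS yl].
  exact: leq_maxl.
exact: leq_maxr.
Qed.

(** Identifying [lam2] with a product measure makes Tonelli's theorem available for it. Both
    measures agree on products of boxes, which determine them. *)
Lemma lebesgue2_prod (L : {sigma_finite_measure set T -> \bar R})
    (lam2 : {measure set (T * T) -> \bar R}) :
  is_lebesgue L -> is_lebesgue2 lam2 ->
  forall E, measurable E -> lam2 E = (L \x L) E.
Proof.
move=> LE L2E E mE; apply/esym.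
apply: (measure_unique boxes2 (fun k => @cube R d k `*` @cube R d k)) => //.
- exact: measurable_prod_boxes2.
- exact: boxes2_setI_closed.
- move=> k; exists (cube k); first exact: boxes_cube.
  by exists (cube k) => //; exact: boxes_cube.
- exact: bigcup_cube2.
- move=> _ [_ [a _ [b _ <-]] [_ [a' _ [b' _ <-]] <-]].
  rewrite /= product_measure1E; [|exact: measurable_box|exact: measurable_box].
  have [ab|->] := box_eq0 a b; last by rewrite set0X !measure0 mul0e.
  have [ab'|->] := box_eq0 a' b'; last by rewrite setX0 !measure0 mule0.
  by rewrite !LE // L2E // EFinM.
- move=> k; rewrite /= product_measure1E; [|exact: measurable_box|exact: measurable_box].
  by rewrite lte_mul_pinfty // ?ge0_fin_numE // lebesgue_cube_fin.
Qed.

End lebesgue_product.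

(** * Normalisation of Gaussian densities *)

Definition quad (R : realType) d (A : 'M[R]_d) (u : 'rV[R]_d) : R :=
  (u *m A *m u^T) 0 0.

Lemma quadE (R : realType) d (A : 'M[R]_d) (u : 'rV[R]_d) :
  quad A u = \sum_i \sum_j A j i * (u 0 j * u 0 i).
Proof.
rewrite /quad mxE; apply: eq_bigr => i _; rewrite !mxE mulr_suml.
by apply: eq_bigr => j _; rewrite mulrAC mulrC.
Qed.

Lemma measurable_quad (R : realType) d (A : 'M[R]_d) :
  measurable_fun [set: Rd R d] (fun x : Rd R d => quad A x).
Proof.
under eq_fun do rewrite quadE.
apply: measurable_sum => i; apply: measurable_sum => j.
by apply: measurable_funM => //; apply: measurable_funM; exact: measurable_coord.
Qed.

Lemma measurable_subr_Rd (R : realType) d (m : 'rV[R]_d) :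
  measurable_fun [set: Rd R d] (fun x : Rd R d => (x : 'rV[R]_d) - m : Rd R d).
Proof.
apply: measurable_fun_Rd => i; under eq_fun do rewrite mxE.
by apply: measurable_funD => //; exact: measurable_coord.
Qed.

Lemma measurable_exp_quad (R : realType) d (A : 'M[R]_d) (m : 'rV[R]_d) :
  measurable_fun [set: Rd R d]
    (fun x : Rd R d => expR (- 2^-1 * quad A ((x : 'rV[R]_d) - m))).
Proof.
apply: measurableT_comp => //; apply: measurable_funM => //.
exact: (measurableT_comp (@measurable_quad R d A) (@measurable_subr_Rd R d m)).
Qed.

(** The integrand is a multiple of the normal density with mean [- c] and variance [a^-1]. *)
Lemma integral_exp_sqr (R : realType) (a c : R) : 0 < a ->
  (\int[lebesgue_measure]_x (expR (- 2^-1 * (a * (x + c) ^+ 2)))%:E =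
   (Num.sqrt (2 * pi / a))%:E)%E.
Proof.
move=> a0; pose s := Num.sqrt a^-1; have s0 : s != 0 by rewrite gt_eqF // sqrtr_gt0 invr_gt0.
have s2 : s ^+ 2 = a^-1 by rewrite sqr_sqrtr // invr_ge0 ltW.
have peak : normal_peak s = (Num.sqrt (2 * pi / a))^-1.
  by rewrite /normal_peak s2; congr (Num.sqrt _)^-1; ring.
have peak0 : normal_peak s != 0 by rewrite gt_eqF // normal_peak_gt0.
rewrite -[RHS]mule1 -(integral_normal_pdf (- c) s).
rewrite -ge0_integralZl //; last 2 first.
- apply/measurable_EFinP; exact: measurable_normal_pdf.
- by move=> x _; rewrite lee_fin normal_pdf_ge0.
apply: eq_integral => x _; rewrite -EFinM normal_pdfE //= peak [in RHS]mulrA divff ?mul1r.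
  by rewrite /normal_fun s2 opprK; congr (expR _)%:E; field; rewrite gt_eqF.
by move: peak0; rewrite peak invr_eq0.
Qed.

Section lebesgue_succ.
Variables (R : realType) (n : nat) (L : {sigma_finite_measure set (Rd R n) -> \bar R}).
Hypothesis LE : is_lebesgue L.
Local Notation leb := (@lebesgue_measure R).

Definition cons_row (z : measurableTypeR R * Rd R n) : Rd R (1 + n) :=
  row_mx ((z.1)%:M : 'M[R]_1) (z.2 : 'rV[R]_n).

Lemma measurable_cons_row : measurable_fun setT cons_row.
Proof.
apply: measurable_fun_Rd => i; rewrite -(splitK i).
case: (fintype.split i) => j /=.
  under eq_fun do rewrite row_mxEl mxE (ord1 j) eqxx mulr1n.
  exact: measurable_fst.
under eq_fun do rewrite row_mxEr.
by apply: (measurableT_comp (@measurable_coord R n j)); exact: measurable_snd.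
Qed.

Lemma cons_row_box (a b : 'rV[R]_(1 + n)) : cons_row @^-1` (box a b) =
  [set` `]a 0 (lshift n 0), b 0 (lshift n 0)]] `*` box (rsubmx a) (rsubmx b).
Proof.
apply/seteqP; split => [[x y] /= h|[x y] [/= h1 h2] i].
  split => [|j]; first by have := h (lshift n 0); rewrite row_mxEl !mxE eqxx in_itv.
  by have := h (rshift 1 j); rewrite row_mxEr !mxE.
rewrite -(splitK i); case: (fintype.split i) => j /=.
  by rewrite row_mxEl !mxE (ord1 j) eqxx mulr1n; move: h1; rewrite in_itv.
by rewrite row_mxEr; have := h2 j; rewrite !mxE.
Qed.

(* Lebesgue measure on R^(1 + n) is built as the image of a product: nothing but
   its values on boxes is known of the measures in the theorem. *)
Lemma lebesgue_succ : exists L' : {sigma_finite_measure set (Rd R (1 + n)) -> \bar R},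
  is_lebesgue L' /\ forall f : Rd R (1 + n) -> \bar R, measurable_fun setT f ->
    (forall x, 0 <= f x)%E ->
    (\int[L']_x f x = \int[L]_y \int[leb]_x f (cons_row (x, y)))%E.
Proof.
pose mu : {measure set (Rd R (1 + n)) -> \bar R} :=
  measure_function_pushforward__canonical__measure_function_Measure
    (leb \x L)%E measurable_cons_row.
have muE : is_lebesgue mu.
  move=> a b ab; rewrite /mu /= /pushforward cons_row_box product_measure1E //; last first.
    exact: measurable_box.
  rewrite LE; last by move=> i; rewrite !mxE.
  rewrite big_split_ord /= big_ord1 EFinM; congr (_ * _)%E; last first.
    by congr EFin; apply: eq_bigr => i _; rewrite !mxE.
  rewrite /= lebesgue_measure_itv /= lte_fin.
  have := ab (lshift n 0); rewrite le_eqVlt => /predU1P[->|->]; last by rewrite -EFinB.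
  by rewrite ltxx subrr.
pose mus : {sigma_finite_measure set (Rd R (1 + n)) -> \bar R} :=
  HB.pack_for (SigmaFiniteMeasure.type (Rd R (1 + n)) R) (Measure.sort mu)
    (Measure_isSigmaFinite.Build _ _ _ mu (lebesgue_sigma_finite muE)).
exists mus; split; first exact: muE.
move=> f mf f0; rewrite -[LHS]/(\int[mu]_x f x)%E.
rewrite /mu ge0_integral_pushforward //; last exact: measurable_cons_row.
rewrite preimage_setT fubini_tonelli2 //; last by move=> z; exact: f0.
exact: (measurableT_comp mf measurable_cons_row).
Qed.

End lebesgue_succ.

(** Induction on the dimension: the first coordinate is integrated out, and the remaining integral
    is Gaussian for the Schur complement. *)
Lemma gauss_lebesgue_ex (R : realType) n :
  exists L : {sigma_finite_measure set (Rd R n) -> \bar R}, is_lebesgue L /\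
    forall (m : 'rV[R]_n) (A : 'M[R]_n), posdef A ->
    (\int[L]_x (expR (- 2^-1 * quad A ((x : 'rV_n) - m)))%:E =
     (Num.sqrt ((2 * pi) ^+ n / \det A))%:E)%E.
Proof.
elim: n => [|n [L [LE Lint]]].
  (* In dimension 0 the empty product gives the only box volume 1, so Lebesgue measure is the Dirac
     mass at the single point. *)
  exists (\d_ (0 : Rd R 0)); split.
    move=> a b _; have b0 : box a b (0 : Rd R 0) by case.
    by rewrite big_ord0 /= diracE mem_set.
  move=> m A Ap; rewrite integral_dirac //; last first.
    apply/measurable_EFinP; exact: measurable_exp_quad.
  rewrite diracT mul1e /quad mxE big_ord0 mulr0 expR0 det_mx00 expr0 divr1.
  by rewrite sqrtr1.
have [L' [L'E L'int]] := lebesgue_succ LE.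
exists L'; split; first exact: L'E.
move=> m A Ap; rewrite L'int; last 2 first.
- apply/measurable_EFinP; exact: measurable_exp_quad.
- by move=> x; rewrite lee_fin expR_ge0.
have p0 := pivot_gt0 Ap; pose m' : 'rV[R]_(1 + n) := m.
(* For fixed [y] the completed square is centred at a point depending on [y], but its integral over
   the line does not depend on that centre. *)
transitivity (\int[L]_y ((Num.sqrt (2 * pi / pivot A))%:E *
    (expR (- 2^-1 * quad (schur A) ((y : 'rV_n) - rsubmx m')))%:E))%E.
  apply: eq_integral => y _; pose w := (y : 'rV_n) - rsubmx m'.
  have H x : cons_row (x, y) - m = row_mx (x - m' 0 (lshift n 0))%:M w.
    rewrite -[X in _ - X](hsubmxK m') /cons_row /= opp_row_mx add_row_mx.
    by congr row_mx; apply/matrixP => i j; rewrite !ord1 !mxE eqxx !mulr1n.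
  under eq_integral => x _ do rewrite H /quad (schur_quad Ap) mulrDr expRD EFinM -addrA.
  rewrite ge0_integralZr // ?integral_exp_sqr //.
  apply/measurable_EFinP; apply: measurableT_comp => //.
  apply: measurable_funM => //; apply: measurable_funM => //.
  by apply: measurable_funX; exact: measurable_funD.
rewrite ge0_integralZl //; last by apply/measurable_EFinP; exact: measurable_exp_quad.
rewrite (Lint _ _ (posdef_schur Ap)) -EFinM -sqrtrM; last first.
  by rewrite divr_ge0 ?mulr_ge0 ?pi_ge0 // ltW.
congr (Num.sqrt _)%:E; rewrite (det_schur Ap) exprS.
have d0 : \det (schur A) != 0 by rewrite gt_eqF //; apply/posdef_det_gt0/posdef_schur.
by field; rewrite d0 gt_eqF.
Qed.

(** * Integration against a density *)

Section integral_density.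
Local Open Scope ereal_scope.
Context d (T : measurableType d) (R : realType).
Variables (nu mu : {measure set T -> \bar R}) (r : T -> R).
Hypotheses (mr : measurable_fun setT r) (r0 : forall x, (0 <= r x)%R).
Hypothesis muE : forall A, measurable A -> mu A = \int[nu]_(x in A) (r x)%:E.

Import HBNNSimple.

(** Both sides are limits along an increasing sequence of simple functions; on the indicator of a
    level set the identity is [muE]. *)
Lemma ge0_integral_density (f : T -> \bar R) : measurable_fun setT f ->
  (forall x, 0 <= f x) -> \int[mu]_x f x = \int[nu]_x (f x * (r x)%:E).
Proof.
move=> mf f0; pose f_ := nnsfun_approx measurableT mf.
have f_cvg x : (f_ n x)%:E @[n --> \oo] --> f x by exact: cvg_nnsfun_approx.
transitivity (limn (fun n => \int[mu]_x (f_ n x)%:E)).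
  rewrite -monotone_convergence //.
  - by apply: eq_integral => x _; apply/esym/cvg_lim => //; exact: f_cvg.
  - by move=> n; exact/measurable_EFinP.
  - by move=> n x _; rewrite lee_fin.
  - by move=> x _ m n mn; rewrite lee_fin; exact/lefP/nd_nnsfun_approx.
rewrite [X in limn X](_ : _ = (fun n => \int[nu]_x ((f_ n x)%:E * (r x)%:E))).
  rewrite -monotone_convergence //.
  - by apply: eq_integral => x _; apply: cvg_lim => //; apply: cvgeZr.
  - by move=> n; apply/measurable_EFinP; exact: measurable_funM.
  - by move=> n x _; rewrite lee_fin mulr_ge0.
  - move=> x _ m n mn; rewrite lee_fin ler_wpM2r //.
    exact/lefP/nd_nnsfun_approx.
apply/funext => n.
have mfn k : measurable (f_ n @^-1` [set k]) by exact: measurable_sfunP.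
transitivity (\sum_(k \in range (f_ n)) \int[mu]_x (k * \1_(f_ n @^-1` [set k]) x)%:E).
  under eq_integral do rewrite fimfunE -fsumEFin//.
  rewrite ge0_integral_fsum//; last 2 first.
  - by move=> y; exact/measurable_EFinP/measurable_funM.
  - by move=> y x _; rewrite nnfun_muleindic_ge0.
transitivity (\sum_(k \in range (f_ n))
    \int[nu]_x (k * \1_(f_ n @^-1` [set k]) x * r x)%:E); last first.
  rewrite -ge0_integral_fsum//; last 2 first.
  - by move=> y; apply/measurable_EFinP; do 2 apply: measurable_funM => //.
  - by move=> y x _; rewrite EFinM mule_ge0 ?nnfun_muleindic_ge0 // lee_fin.
  apply: eq_integral => x _; rewrite [in RHS]fimfunE -fsumEFin//.
  by rewrite ge0_mule_fsuml // => k; rewrite nnfun_muleindic_ge0.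
apply: eq_fsbigr => k; rewrite inE => -[x _ fxk].
have k0 : (0 <= k)%R by rewrite -fxk.
under eq_integral do rewrite EFinM.
rewrite ge0_integralZl //; last by apply/measurable_EFinP.
rewrite integral_indic // setIT muE //.
under [in RHS]eq_integral do rewrite -mulrA EFinM.
rewrite ge0_integralZl //; last 2 first.
- by apply/measurable_EFinP; exact: measurable_funM.
- by move=> y _; rewrite lee_fin mulr_ge0.
rewrite integral_mkcond; congr (_ * _); apply: eq_integral => y _.
rewrite patchE indicE; case: ifPn => _; first by rewrite mul1r.
by rewrite mul0r.
Qed.

Lemma integrable_density (f : T -> R) : mu.-integrable setT (EFin \o f) ->
  nu.-integrable setT (fun x => (f x * r x)%:E).
Proof.
move=> /integrableP[/measurable_EFinP mf intf]; apply/integrableP; split.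
  by apply/measurable_EFinP; exact: measurable_funM.
move: intf; rewrite ge0_integral_density //; last first.
  by apply: measurableT_comp => //; exact/measurable_EFinP.
by under eq_integral do rewrite /= -EFinM -[X in (_ * X)%R](ger0_norm (r0 _)) -normrM.
Qed.

(** Multiplication by [r >= 0] commutes with taking positive and negative parts, so the nonnegative
    case applies to each. *)
Lemma integral_density (f : T -> R) : measurable_fun setT f ->
  \int[mu]_x (f x)%:E = \int[nu]_x (f x * r x)%:E.
Proof.
move=> mf; rewrite integralE [RHS]integralE.
have mf' : measurable_fun setT (EFin \o f) by exact/measurable_EFinP.
rewrite !ge0_integral_density; [|exact: measurable_funeneg|by []|exact: measurable_funepos|by []].
congr (_ - _); apply: eq_integral => x _.
  by rewrite !funeposE /= -[0]/(0%R%:E) -!EFin_max -EFinM maxr_pMl // mul0r.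
by rewrite !funenegE /= -[0]/(0%R%:E) -!EFin_max -EFinM maxr_pMl // mul0r mulNr.
Qed.

End integral_density.

(** * Calculus of integrals with known values *)

Section has_integral.
Context d (T : measurableType d) (R : realType).
Implicit Types (mu : {measure set T -> \bar R}) (f g : T -> R) (v w : R).

(* The integral is linear only on integrable functions; pairing integrability with
   the value makes the two propagate together. *)
Definition has_integral (mu : {measure set T -> \bar R}) (f : T -> R) (v : R) :=
  mu.-integrable setT (EFin \o f) /\ \int[mu]_(x in setT) f x = v.

Lemma has_integralE mu f v : has_integral mu f v -> (\int[mu]_x (f x)%:E = v%:E)%E.
Proof. by move=> [fi <-]; rewrite /Rintegral fineK //; exact: integrable_fin_num. Qed.

Lemma has_integral_measurable mu f v : has_integral mu f v -> measurable_fun setT f.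
Proof. by move=> [/measurable_int/measurable_EFinP]. Qed.

Lemma has_integralI mu f v : mu.-integrable setT (EFin \o f) ->
  (\int[mu]_x (f x)%:E = v%:E)%E -> has_integral mu f v.
Proof. by move=> fi fE; split; rewrite // /Rintegral fE. Qed.

Lemma has_integral_ext mu f g v w : has_integral mu f v -> f =1 g -> v = w ->
  has_integral mu g w.
Proof. by move=> fv /funext <- <-. Qed.

Lemma has_integralD mu f g v w : has_integral mu f v -> has_integral mu g w ->
  has_integral mu (fun x => f x + g x) (v + w).
Proof.
move=> [fi <-] [gi <-]; split; last by rewrite RintegralD.
exact: (integrableD measurableT fi gi).
Qed.

Lemma has_integralZ mu c f v : has_integral mu f v ->
  has_integral mu (fun x => c * f x) (c * v).
Proof.
move=> [fi <-]; split; last by rewrite RintegralZl.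
exact: (integrableZl measurableT c fi).
Qed.

Lemma has_integralB mu f g v w : has_integral mu f v -> has_integral mu g w ->
  has_integral mu (fun x => f x - g x) (v - w).
Proof.
move=> fv /(has_integralZ (-1)) gw; apply: has_integral_ext (has_integralD fv gw) _ _.
  by move=> x; rewrite mulN1r.
by rewrite mulN1r.
Qed.

Lemma has_integral_sum mu (I : Type) (s : seq I) (f : I -> T -> R) (v : I -> R) :
  (forall i, has_integral mu (f i) (v i)) ->
  has_integral mu (fun x => \sum_(i <- s) f i x) (\sum_(i <- s) v i).
Proof.
move=> fv; elim: s => [|a s IH].
  rewrite big_nil; under eq_fun do rewrite big_nil.
  split; first exact: integrable0.
  by rewrite /Rintegral integral0.
rewrite big_cons; under eq_fun do rewrite big_cons.
exact: has_integralD.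
Qed.

Lemma has_integral_cst (P : probability T R) c : has_integral P (fun=> c) c.
Proof.
split; first exact: finite_measure_integrable_cst.
by rewrite Rintegral_cst // [X in fine X](probability_setT P) mulr1.
Qed.

Lemma le_has_integral mu f g v w : has_integral mu f v -> has_integral mu g w ->
  (forall x, f x <= g x) -> v <= w.
Proof.
move=> [fi <-] [gi <-] fg; rewrite /Rintegral fine_le ?integrable_fin_num //.
by apply: le_integral => // x _; rewrite lee_fin.
Qed.

End has_integral.

(** * Mean and covariance of a Gaussian *)

(* Differentiate at B = 1 in the directions B = 1 + s *: delta_mx i j. *)
Lemma precision_stationary (R : realType) d (A S : 'M[R]_d) :
  A^T = A -> S^T = S ->
  (forall B, B \in unitmx -> ln (\det B ^+ 2) + \tr (A *m S) <= \tr (B *m A *m B^T *m S)) ->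
  A *m S = 1%:M.
Proof.
move=> As Ss H; apply/matrixP => j i.
pose E : 'M[R]_d := delta_mx i j.
(* Up to transposition the matrix is lower triangular, so its determinant is the product of the
   diagonal. *)
have detE s : \det (1%:M + s *: E) = 1 + s *+ (i == j).
  wlog ji : i j @E / (j <= i)%N => [hw|].
    have [|/ltnW ij] := leqP j i; first exact: hw.
    by rewrite -det_tr linearD linearZ /= trmx1 trmx_delta hw // eq_sym.
  rewrite /E det_trig.
    have [->|ij] := eqVneq i j.
      rewrite (bigD1 j) //= big1 => [|k kj]; rewrite !mxE ?eqxx ?mulr1 //.
      by rewrite (negbTE kj) mulr0 addr0.
    rewrite big1 ?addr0 // => k _; rewrite !mxE eqxx.
    case: eqVneq => [->|]; last by rewrite mulr0 addr0.
    by rewrite (negbTE ij) mulr0 addr0.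
  apply/is_trig_mxP => k l kl; rewrite !mxE.
  have -> : (k == l) = false by apply/negbTE; rewrite -val_eqE /= ltn_eqF.
  case: eqVneq => [ki|]; last by rewrite mulr0 addr0.
  case: eqVneq => [lj|]; last by rewrite mulr0 addr0.
  by move: kl; rewrite ki lj ltnNge ji.
pose t := (A *m S) j i; pose q := \tr (E *m A *m E^T *m S).
have trE : \tr (E *m (A *m S)) = t.
  rewrite /mxtrace (bigD1 i) //= big1 ?addr0 => [|k ki].
    rewrite mxE (bigD1 j) //= big1 ?addr0 => [|k kj].
      by rewrite [E i j]mxE !eqxx mul1r.
    by rewrite [E i k]mxE (negbTE kj) andbF mul0r.
  by rewrite mxE big1 // => l _; rewrite [E k l]mxE (negbTE ki) mul0r.
have trB s : \tr ((1%:M + s *: E) *m A *m (1%:M + s *: E)^T *m S) =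
    \tr (A *m S) + 2 * s * t + s ^+ 2 * q.
  rewrite linearD linearZ /= trmx1 !(mulmxDl, mulmxDr, mul1mx, mulmx1).
  do 3 rewrite -?scalemxAl -?scalemxAr; rewrite scalerA.
  rewrite !mxtraceD !mxtraceZ -/q -(mulmxA E A S) -(mulmxA A E^T S) trE.
  have -> : \tr (A *m (E^T *m S)) = t.
    rewrite -mxtrace_tr !trmx_mul trmxK As Ss mxtrace_mulC mulmxA.
    by rewrite mxtrace_mulC trE.
  by ring.
rewrite [RHS]mxE eq_sym -/t.
pose de : R := (i == j)%:R.
(* With [x = s * de >= - 1/2], [ln (1 + x) >= x / (1 + x) >= x - 2 * s ^+ 2]; doubling this bounds
   the logarithm of the squared determinant. *)
have key s : `|s| <= 2^-1 -> 2 * s * de - 4 * s ^+ 2 <= 2 * s * t + s ^+ 2 * q.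
  move=> s2; have [s2l s2r] : - 2^-1 <= s /\ s <= 2^-1 by apply/andP; rewrite -ler_norml.
  have de01 : de = 0 \/ de = 1 by rewrite /de; case: eqP; [right|left].
  have sde : 2^-1 <= 1 + s * de.
    by case: de01 => ->; lra.
  have Bu : 1%:M + s *: E \in unitmx.
    by rewrite unitmxE unitfE detE -mulr_natr gt_eqF // -/de; lra.
  have := H _ Bu; rewrite trB detE -mulr_natr -/de => h.
  have hln : s * de / (1 + s * de) <= ln (1 + s * de).
    rewrite -lerN2 -lnV ?posrE; last lra.
    have inv1 : (1 + s * de)^-1 = 1 + - (s * de / (1 + s * de)).
      by field; rewrite gt_eqF //; lra.
    rewrite [X in ln X]inv1; apply: le_ln1Dx.
    by rewrite ltrN2 ltr_pdivrMr; lra.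
  move: h; rewrite lnXn; last lra.
  have : s * de - 2 * s ^+ 2 <= s * de / (1 + s * de).
    rewrite ler_pdivlMr; last lra.
    by case: de01 => ->; nra.
  move: hln; rewrite mulr2n; move: (ln _) (_ / _) => l x; lra.
pose c := q + 4; pose u := t - de.
have key' s : `|s| <= 2^-1 -> 0 <= 2 * s * u + s ^+ 2 * c.
  by move=> /key; rewrite /u /c; lra.
suff : u = 0 by rewrite /u => /eqP; rewrite subr_eq0 => /eqP.
apply/eqP; rewrite -normr_le0 leNgt; apply/negP => u0.
(* The point [s = - (k * u)] is tested, where the bound reads [0 <= k * u ^+ 2 * (k * c - 2)]. This
   [k] ensures both [|s| <= 1/2] and [k * c < 1], a contradiction. *)
pose k := (`|c| + 1 + 2 * `|u|)^-1.
have k0 : 0 < k by rewrite invr_gt0; have := normr_ge0 c; lra.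
have k1 : k * (`|c| + 1 + 2 * `|u|) = 1 by rewrite mulVf // gt_eqF // -invr_gt0.
have c0 := normr_ge0 c.
have kc : k * `|c| < 1.
  by rewrite -k1 ltr_pM2l // -addrA ltrDl addr_gt0 ?mulr_gt0.
have ku : `|- (k * u)| <= 2^-1.
  rewrite normrN normrM (gtr0_norm k0).
  have : k * (2 * `|u|) <= 1.
    by rewrite -[leRHS]k1 ler_pM2l // lerDr addr_ge0.
  by rewrite mulrCA; move: (k * _) => x; lra.
have := key' _ ku; have := ler_norm c.
have u2 : 0 < u ^+ 2 by rewrite exprn_even_gt0 // -normr_gt0.
move=> h1 h2.
have : 0 <= k * u ^+ 2 * (k * c - 2).
  by apply: le_trans h2 _; rewrite le_eqVlt; apply/orP; left; apply/eqP; ring.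
have kc2 : k * c <= k * `|c| by rewrite ler_wpM2l // ltW.
rewrite (pmulr_rge0 _ (mulr_gt0 k0 u2)) subr_ge0 => h.
by have := le_lt_trans (le_trans h kc2) kc; rewrite ltNge ler1n.
Qed.

Section gauss_pdf_theory.
Variables (R : realType) (d : nat).
Implicit Types (m : 'rV[R]_d) (S : 'M[R]_d).

Lemma gauss_pdf_gt0 m S x : posdef S -> 0 < gauss_pdf m S x.
Proof.
move=> /posdef_det_gt0 S0; rewrite /gauss_pdf !mulr_gt0 ?expR_gt0 ?powR_gt0 //.
by rewrite mulr_gt0 ?pi_gt0.
Qed.

Lemma measurable_gauss_pdf m S :
  measurable_fun setT (fun x : Rd R d => gauss_pdf m S x).
Proof. by apply: measurable_funM => //; exact: measurable_exp_quad. Qed.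

Lemma ln_gauss_pdf m S x : posdef S -> ln (gauss_pdf m S x) =
  - (d%:R / 2) * ln (2 * pi) - 2^-1 * ln (\det S) - 2^-1 * quad (invmx S) (x - m).
Proof.
move=> /posdef_det_gt0 S0.
have pi0 : 0 < 2 * pi :> R by rewrite mulr_gt0 ?pi_gt0.
have a0 := powR_gt0 (- (d%:R / 2)) pi0; have b0 := powR_gt0 (- 2^-1) S0.
rewrite /gauss_pdf lnM ?posrE ?expR_gt0 ?mulr_gt0 // lnM ?posrE // !ln_powR expRK.
by rewrite !mulNr.
Qed.

Lemma integral_gauss_pdf (lam : {measure set (Rd R d) -> \bar R}) m S :
  is_lebesgue lam -> posdef S -> (\int[lam]_x (gauss_pdf m S x)%:E = 1)%E.
Proof.
move=> lamE Sp; have [L [LE Lint]] := gauss_lebesgue_ex R d.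
have S0 := posdef_det_gt0 Sp.
have pi0 : 0 < 2 * pi :> R by rewrite mulr_gt0 ?pi_gt0.
(* Uniqueness of Lebesgue measure transfers the integral computed for one particular [L] to
   [lam]. *)
rewrite (eq_measure_integral L); last by move=> A mA _; exact: (lebesgue_unique lamE LE).
under eq_integral do rewrite EFinM.
rewrite ge0_integralZl //; last 2 first.
- by apply/measurable_EFinP; exact: measurable_exp_quad.
- by rewrite lee_fin mulr_ge0 ?powR_ge0.
rewrite (Lint _ _ (posdef_invmx Sp)) -EFinM det_inv invrK -powR12_sqrt; last first.
  by rewrite mulr_ge0 ?exprn_ge0 // ltW.
have -> : ((2 * pi) ^+ d * \det S) `^ 2^-1 = (2 * pi) `^ (d%:R / 2) * \det S `^ 2^-1.
  by rewrite powRM ?exprn_ge0 ?ltW // -powR_mulrn ?ltW // -powRrM.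
rewrite !powRN; congr EFin.
field; rewrite !gt_eqF ?powR_gt0 //.
Qed.

End gauss_pdf_theory.

(** * First and second moments *)

Section moments.
Variables (R : realType) (d : nat) (P : probability (Rd R d) R).
Hypothesis P2 : finite_second_moments P.
Local Notation crd x i := ((x : 'rV[R]_d) 0 i).

Lemma integrable_coord i : P.-integrable setT (fun x : Rd R d => (crd x i)%:E).
Proof.
apply: (@le_integrable _ _ _ _ _ measurableT _ (fun x : Rd R d => (1 + crd x i ^+ 2)%:E)).
- by apply/measurable_EFinP; exact: measurable_coord.
- move=> x _; rewrite !abse_EFin lee_fin [leRHS]ger0_norm ?addr_ge0 ?sqr_ge0 //.
  by rewrite -real_normK ?num_real //; set t := `|_|; nra.
- exact: (integrableD measurableT (finite_measure_integrable_cst P 1 measurableT) (P2 i)).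
Qed.

Lemma mean_coord i a :
  has_integral P (fun x : Rd R d => crd x i - a) (mean P 0 i - a).
Proof.
apply: has_integralB (has_integral_cst P a); split; first exact: integrable_coord.
by rewrite mxE.
Qed.

Lemma integrable_coordM i j :
  P.-integrable setT (fun x : Rd R d => (crd x i * crd x j)%:E).
Proof.
apply: (@le_integrable _ _ _ _ _ measurableT _
  (fun x : Rd R d => (crd x i ^+ 2 + crd x j ^+ 2)%:E)).
- by apply/measurable_EFinP; apply: measurable_funM; exact: measurable_coord.
- move=> x _; rewrite !abse_EFin lee_fin [leRHS]ger0_norm ?addr_ge0 ?sqr_ge0 //.
  rewrite normrM -(real_normK (num_real (crd x i))) -(real_normK (num_real (crd x j))).
  by move: `|_| `|_| (normr_ge0 (crd x i)) (normr_ge0 (crd x j)) => s t; nra.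
- exact: (integrableD measurableT (P2 i) (P2 j)).
Qed.

Lemma cov_coord i j : has_integral P
  (fun x : Rd R d => (crd x i - mean P 0 i) * (crd x j - mean P 0 j)) (cov P i j).
Proof.
suff [v [h _]] : exists v, has_integral P (fun x : Rd R d =>
    (crd x i - mean P 0 i) * (crd x j - mean P 0 j)) v by split => //; rewrite [RHS]mxE.
have xy : has_integral P (fun x : Rd R d => crd x i * crd x j) _ :=
  conj (integrable_coordM i j) erefl.
have xi := has_integralZ (mean P 0 j) (mean_coord i (mean P 0 i)).
have xj := has_integralZ (mean P 0 i) (mean_coord j 0).
eexists; apply: has_integral_ext (has_integralB (has_integralB xy xi) xj) _ erefl.
by move=> x; ring.
Qed.

Lemma cov_sym : (cov P)^T = cov P.
Proof.
apply/matrixP => i j; rewrite !mxE; apply: eq_Rintegral => x _.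
by rewrite mulrC.
Qed.

(** Expanding around the mean: the linear terms integrate to zero. *)
Lemma moment2 i j (a : 'rV[R]_d) : has_integral P
  (fun x : Rd R d => (crd x i - a 0 i) * (crd x j - a 0 j))
  (cov P i j + (mean P - a) 0 i * (mean P - a) 0 j).
Proof.
have c := cov_coord i j.
have xi := has_integralZ ((mean P - a) 0 j) (mean_coord i (mean P 0 i)).
have xj := has_integralZ ((mean P - a) 0 i) (mean_coord j (mean P 0 j)).
have k := has_integral_cst P ((mean P - a) 0 i * (mean P - a) 0 j).
apply: has_integral_ext (has_integralD c (has_integralD (has_integralD xi xj) k)) _ _.
  by move=> x; rewrite [(_ - a) 0 i]mxE [(_ - a) 0 j]mxE ![(- a) 0 _]mxE; ring.
by rewrite !subrr !mulr0 !add0r.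
Qed.

(** Integrals of quadratic polynomials depend on [P] only through its mean and covariance, whence a
    bound common to all [P] and [Q] with given moments. *)
Lemma moment_quad (A : 'M[R]_d) (a : 'rV[R]_d) :
  has_integral P (fun x : Rd R d => quad A ((x : 'rV_d) - a))
    (\tr (A *m cov P) + quad A (mean P - a)).
Proof.
apply: has_integral_ext (has_integral_sum _ (fun i =>
  has_integral_sum _ (fun j => has_integralZ (A j i) (moment2 j i a)))) _ _.
  move=> x; rewrite quadE; apply: eq_bigr => i _; apply: eq_bigr => j _.
  by rewrite ![(_ - a) 0 _]mxE ![(- a) 0 _]mxE.
rewrite quadE; under eq_bigr => i _.
  under eq_bigr => j _ do rewrite mulrDr.
  rewrite big_split /=.
  over.
rewrite big_split /=; congr (_ + _); rewrite exchange_big /=.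
apply: eq_bigr => i _; rewrite mxE; apply: eq_bigr => j _.
by rewrite -[in RHS]cov_sym [in RHS]mxE.
Qed.

End moments.

Lemma posdef_quad_eq0 (R : realType) d (A : 'M[R]_d) u : posdef A -> quad A u <= 0 -> u = 0.
Proof.
move=> [_ Ap] Au; apply/eqP; apply: contraTT Au => u0; rewrite -ltNge; exact: Ap.
Qed.

(** * Identification of the Gaussian parameters *)

Section gaussian_parameters.
Variables (R : realType) (d : nat).
Variables (lam : {measure set (Rd R d) -> \bar R}) (P : probability (Rd R d) R).
Variables (m : 'rV[R]_d) (S : 'M[R]_d).
Hypotheses (lamE : is_lebesgue lam) (P2 : finite_second_moments P) (Sp : posdef S).
Hypothesis PE : forall A : set (Rd R d), measurable A ->
  P A = (\int[lam]_(x in A) (gauss_pdf m S x)%:E)%E.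

(** Here [h = ln (g' / g)], and [expR h] has integral 1 under [P] because [P] has density [g].
    Integrating [h <= expR h - 1] gives the claim. *)
Lemma gibbs_gauss (m' : 'rV[R]_d) (S' : 'M[R]_d) : posdef S' ->
  ln (\det S) + \tr (invmx S *m cov P) + quad (invmx S) (mean P - m) <=
  ln (\det S') + \tr (invmx S' *m cov P) + quad (invmx S') (mean P - m').
Proof.
move=> Sp'; pose g := gauss_pdf m S; pose g' := gauss_pdf m' S'.
have g0 x : 0 < g x by exact: gauss_pdf_gt0.
have g0' x : 0 < g' x by exact: gauss_pdf_gt0.
pose c := 2^-1 * (ln (\det S) - ln (\det S')).
pose h (x : Rd R d) := c + 2^-1 * quad (invmx S) ((x : 'rV_d) - m)
  - 2^-1 * quad (invmx S') ((x : 'rV_d) - m').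
have hE := has_integralB (has_integralD (has_integral_cst P c)
  (has_integralZ 2^-1 (moment_quad P2 (invmx S) m)))
  (has_integralZ 2^-1 (moment_quad P2 (invmx S') m')).
have mh : measurable_fun setT (expR \o h).
  by apply: measurableT_comp => //; exact: has_integral_measurable hE.
have ghE x : expR (h x) * g x = g' x.
  have -> : h x = ln (g' x) - ln (g x) by rewrite !ln_gauss_pdf // /h /c; lra.
  have pg : g x \is Num.pos by exact: g0.
  have pg' : g' x \is Num.pos by exact: g0'.
  by rewrite expRB (lnK pg) (lnK pg') (divfK (lt0r_neq0 (g0 x))).
have eh1 : (\int[P]_x (expR (h x))%:E = 1)%E.
  rewrite (integral_density (measurable_gauss_pdf m S) (fun x => ltW (g0 x)) PE) //.
  under eq_integral do rewrite ghE.
  exact: integral_gauss_pdf.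
have eh : has_integral P (expR \o h) 1.
  apply: has_integralI => //; apply/integrableP; split; first exact/measurable_EFinP.
  under eq_integral do rewrite /= ger0_norm ?expR_ge0 //.
  by rewrite eh1 ltry.
have := le_has_integral hE (has_integralB eh (has_integral_cst P 1)).
rewrite subrr => le0.
move: le0; rewrite /c => le0; suff : forall x, h x <= expR (h x) - 1 by move=> /le0; lra.
by move=> x; rewrite lerBrDl expR_ge1Dx.
Qed.

(** Comparison with the Gaussian of the same matrix centred at [mean P] makes the quadratic form of
    [mean P - m] nonpositive. *)
Lemma gaussian_mean : mean P = m.
Proof.
have := gibbs_gauss (mean P) Sp; rewrite subrr lerD2l [leRHS]/quad !mul0mx mxE.
by move/(posdef_quad_eq0 (posdef_invmx Sp))/eqP; rewrite subr_eq0 => /eqP.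
Qed.

(** Comparison with the Gaussians of mean [m] and precision [B *m invmx S *m B^T]: the precision
    [invmx S] is optimal at [B = 1], hence stationary. *)
Lemma gaussian_cov : cov P = S.
Proof.
have Vp := posdef_invmx Sp; have Su := posdef_unitmx Sp.
suff VS : invmx S *m cov P = 1%:M by rewrite -[RHS]mulmx1 -VS mulKVmx.
apply: precision_stationary; [exact: (proj1 Vp)|exact: cov_sym|].
move=> B Bu; have Cp := posdef_congr Vp Bu.
have := gibbs_gauss m (posdef_invmx Cp).
rewrite gaussian_mean subrr /quad !mul0mx mxE !addr0 invmxK.
have dB : \det B != 0 by rewrite -unitfE -unitmxE.
have B0 : 0 < \det B ^+ 2 by rewrite exprn_even_gt0.
have S0 := posdef_det_gt0 Sp.
rewrite det_inv !det_mulmx det_tr det_inv.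
have -> : (\det B / \det S * \det B)^-1 = \det S / (\det B ^+ 2).
  by field; rewrite dB gt_eqF.
by rewrite ln_div ?posrE //; lra.
Qed.

End gaussian_parameters.

(** * Entropy lower bound *)

(* With p = sqrt a, q = sqrt b, the relative entropy a ln (a / b) - a + b is at
   least (p - q)^2, and (p - q - s (p + q))^2 >= 0; keeping s free avoids
   Cauchy-Schwarz when the bound is integrated. *)
Lemma entropy_pointwise (R : realType) (a b s : R) (e : bool) : 0 <= a -> 0 < b ->
  a * ln b + (a - b) + 2 * s * (e%:R * (a - b)) - 2 * s ^+ 2 * (a + b) <= a * ln a.
Proof.
(* At [a = 0] the left side is a quadratic in [s] times [b], and [0 * ln 0] is 0. *)
move=> a0 b0; have [->|an0] := eqVneq a 0.
  have h1 : 0 <= b * (1 + s) ^+ 2 by rewrite mulr_ge0 ?sqr_ge0 ?ltW.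
  have h2 : 0 <= b * s ^+ 2 by rewrite mulr_ge0 ?sqr_ge0 ?ltW.
  by rewrite !mul0r; case: e => /=; lra.
have {an0}a0 : 0 < a by rewrite lt_neqAle eq_sym an0.
pose p := Num.sqrt a; pose q := Num.sqrt b.
have p0 : 0 < p by rewrite sqrtr_gt0.
have q0 : 0 < q by rewrite sqrtr_gt0.
have aE : a = p ^+ 2 by rewrite sqr_sqrtr ?ltW.
have bE : b = q ^+ 2 by rewrite sqr_sqrtr ?ltW.
(* Multiplied by [2 * p ^+ 2], this gives [a ln a - a ln b - (a - b) >= (p - q) ^+ 2]. *)
have lnpq : ln q - ln p <= q / p - 1.
  rewrite -ln_div ?posrE // -[X in ln X](subrK 1) addrC.
  by rewrite le_ln1Dx // ltrBrDr addNr divr_gt0.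
have plnpq : p ^+ 2 * (ln q - ln p) <= p * q - p ^+ 2.
  rewrite (le_trans (ler_wpM2l (ltW (exprn_gt0 2 p0)) lnpq)) // le_eqVlt.
  by apply/orP; left; apply/eqP; field; rewrite gt_eqF.
rewrite aE bE !lnXn // !mulr2n.
move: (ln p) (ln q) plnpq => lp lq h.
have sq : 0 <= (p - q - s * e%:R * (p + q)) ^+ 2 by exact: sqr_ge0.
(* Since [(p + q)^2 + (p - q)^2 = 2 (a + b)], this replaces [(p + q)^2] by [2 (a + b)]. *)
have sq' : 0 <= s ^+ 2 * (p - q) ^+ 2 by rewrite mulr_ge0 ?sqr_ge0.
have sq'' : 0 <= s ^+ 2 * (p + q) ^+ 2 by rewrite mulr_ge0 ?sqr_ge0.
by case: e sq => /= sq; lra.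
Qed.

(** Meant for [f = r ln r], whose integral may be infinite: positive and negative parts are compared
    separately. *)
Lemma le_integral_integrable d (T : measurableType d) (R : realType)
    (mu : {measure set T -> \bar R}) (f g : T -> \bar R) :
  mu.-integrable setT g -> measurable_fun setT f -> (forall x, g x <= f x)%E ->
  (\int[mu]_x g x <= \int[mu]_x f x)%E.
Proof.
move=> gi mf gf; have mg := measurable_int mu gi.
rewrite integralE [leRHS]integralE; apply: leeB; apply: ge0_le_integral => //.
- exact: measurable_funepos.
- exact: measurable_funepos.
- by move=> x _; rewrite !funeposE le_max2.
- exact: measurable_funeneg.
- exact: measurable_funeneg.
- by move=> x _; rewrite !funenegE le_max2 ?leeN2.
Qed.

Section density_measure.
Context d (T : measurableType d) (R : realType).
Variables (nu : {measure set T -> \bar R}) (r : T -> R).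
Hypotheses (mr : measurable_fun setT r) (r0 : forall x, 0 <= r x).

Definition density_measure (A : set T) : \bar R := (\int[nu]_(x in A) (r x)%:E)%E.

Let density0 : density_measure set0 = 0%E.
Proof. exact: integral_set0. Qed.

Let density_ge0 A : (0 <= density_measure A)%E.
Proof. by apply: integral_ge0 => x _; rewrite lee_fin. Qed.

Let density_sigma_additive : semi_sigma_additive density_measure.
Proof.
move=> A mA tA mUA; rewrite /density_measure ge0_integral_bigcup //; last 2 first.
- by apply/measurable_EFinP; exact: measurable_funTS.
- by move=> x _; rewrite lee_fin.
by apply: is_cvg_ereal_nneg_natsum_cond => n _ _; exact: density_ge0.
Qed.

Lemma density_probability : (\int[nu]_x (r x)%:E = 1)%E ->
  exists P : probability T R,
    forall A, P A = (\int[nu]_(x in A) (r x)%:E)%E.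
Proof.
move=> r1.
pose M := isMeasure.Build _ _ _ density_measure density0 density_ge0 density_sigma_additive.
pose m : {measure set T -> \bar R} := HB.pack_for (Measure.type T R) density_measure M.
pose P : probability T R := HB.pack_for (probability T R) (Measure.sort m)
  (Measure_isProbability.Build _ _ _ m r1).
by exists P.
Qed.

End density_measure.

Lemma has_integral_density d (T : measurableType d) (R : realType)
    (nu : {measure set T -> \bar R}) (P : probability T R) (r f : T -> R) v :
  measurable_fun setT r -> (forall z, 0 <= r z) ->
  (forall A, measurable A -> P A = (\int[nu]_(z in A) (r z)%:E)%E) ->
  has_integral P f v -> has_integral nu (fun z => f z * r z) v.
Proof.
move=> mr r0 PE fv; apply: has_integralI.
  exact: (integrable_density mr r0 PE (proj1 fv)).
by rewrite -(integral_density mr r0 PE (has_integral_measurable fv)) (has_integralE fv).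
Qed.

Lemma has_integral_indic d (T : measurableType d) (R : realType) (M : probability T R)
    (E : set T) : measurable E -> has_integral M \1_E (fine (M E)).
Proof.
move=> mE; split; first exact: integrable_indic.
by rewrite /Rintegral integral_indic // setIT.
Qed.

(** The pointwise bound is integrated with [e] the indicator of [E]; [r - q] has integral 0 and
    [r + q] has integral 2. As [w] is the integral of [ln q] under [P], this bounds the relative
    entropy from below by the gap between [P E] and [Q E]. *)
Lemma entropy_lower_bound d (T : measurableType d) (R : realType)
    (nu : {measure set T -> \bar R}) (P Q : probability T R) (r q : T -> R) (w s : R)
    (E : set T) :
  measurable_fun setT r -> (forall z, 0 <= r z) ->
  measurable_fun setT q -> (forall z, 0 < q z) ->
  (forall A, measurable A -> P A = (\int[nu]_(z in A) (r z)%:E)%E) ->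
  (forall A, measurable A -> Q A = (\int[nu]_(z in A) (q z)%:E)%E) ->
  has_integral P (fun z => ln (q z)) w -> measurable E ->
  ((w + 2 * s * (fine (P E) - fine (Q E)) - 4 * s ^+ 2)%:E <=
   \int[nu]_z (r z * ln (r z))%:E)%E.
Proof.
move=> mr r0 mq q0 PE QE lnq mE.
have q0' z : 0 <= q z by exact: ltW.
have hl := has_integral_density mr r0 PE lnq.
have hr := has_integral_density mr r0 PE (has_integral_cst P 1).
have hq := has_integral_density mq q0' QE (has_integral_cst Q 1).
have hrE := has_integral_density mr r0 PE (has_integral_indic P mE).
have hqE := has_integral_density mq q0' QE (has_integral_indic Q mE).
have := has_integralB (has_integralD (has_integralD hl (has_integralB hr hq))
   (has_integralZ (2 * s) (has_integralB hrE hqE)))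
   (has_integralZ (2 * s ^+ 2) (has_integralD hr hq)).
set g := (fun x => _) => hg.
have -> : w + 2 * s * (fine (P E) - fine (Q E)) - 4 * s ^+ 2 =
  w + (1 - 1) + 2 * s * (fine (P E) - fine (Q E)) - 2 * s ^+ 2 * (1 + 1) by ring.
rewrite -(has_integralE hg); apply: le_integral_integrable.
- exact: (proj1 hg).
- by apply/measurable_EFinP; apply: measurable_funM => //; exact: measurableT_comp.
- move=> z; rewrite lee_fin (le_trans _ (entropy_pointwise s (z \in E) (r0 z) (q0 z))) //.
  by rewrite /g indicE le_eqVlt; apply/orP; left; apply/eqP; ring.
Qed.

(** * The optimal density *)

Section quadratic_forms.
Variables (R : realType) (d : nat).
Implicit Types (A B : 'M[R]_d) (u v w : 'rV[R]_d).

Lemma quadD A B u : quad (A + B) u = quad A u + quad B u.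
Proof. by rewrite /quad mulmxDr mulmxDl mxE. Qed.

Lemma quadZ c A u : quad (c *: A) u = c * quad A u.
Proof. by rewrite /quad -scalemxAr -scalemxAl mxE. Qed.

Lemma trmx00 (M : 'M[R]_1) : M^T 0 0 = M 0 0.
Proof. by rewrite mxE. Qed.

Lemma quad_subr A v w : A^T = A ->
  quad A (v - w) = quad A v - 2 * (v *m A *m w^T) 0 0 + quad A w.
Proof.
move=> As; have wAv : (w *m A *m v^T) 0 0 = (v *m A *m w^T) 0 0.
  by rewrite -trmx00 !trmx_mul trmxK As mulmxA.
have eB (M N : 'M[R]_1) : (M - N) 0 0 = M 0 0 - N 0 0 by rewrite !mxE.
rewrite /quad linearB /= !(mulmxBl, mulmxBr) !eB wAv.
by ring.
Qed.

Lemma sqnormE u : sqnorm u = quad 1%:M u.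
Proof.
by rewrite /sqnorm /quad mulmx1 mxE; apply: eq_bigr => i _; rewrite mxE expr2.
Qed.

Lemma invmx_scale (k : R) A : k != 0 -> A \in unitmx -> invmx (k *: A) = k^-1 *: invmx A.
Proof.
move=> k0 Au; have kAu : k *: A \in unitmx.
  by rewrite unitmxE detZ unitrM unitrX ?unitfE // -unitfE -unitmxE.
apply: (can_inj (mulmxK kAu)); rewrite mulVmx // -scalemxAl -scalemxAr scalerA.
by rewrite mulVf // scale1r mulVmx.
Qed.

Definition opt_density (m1 m2 : 'rV[R]_d) S1 X (k : R) (z : Rd R d * Rd R d) : R :=
  gauss_pdf m1 S1 z.1 *
  gauss_pdf (m2 + ((z.1 : 'rV_d) - m1) *m X) (k *: X) z.2.

Variables (m1 m2 : 'rV[R]_d) (S1 X : 'M[R]_d) (k : R).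
Hypotheses (S1p : posdef S1) (Xp : posdef X) (k0 : 0 < k).
Local Notation q := (opt_density m1 m2 S1 X k).

Lemma opt_density_gt0 z : 0 < q z.
Proof. by rewrite mulr_gt0 ?gauss_pdf_gt0 //; exact: posdefZ. Qed.

Lemma measurable_affine (N : 'M[R]_d) (a b : 'rV[R]_d) :
  measurable_fun setT (fun z : Rd R d * Rd R d =>
    (z.2 : 'rV_d) - (a + ((z.1 : 'rV_d) - b) *m N) : Rd R d).
Proof.
apply: measurable_fun_Rd => i.
under eq_fun do rewrite !mxE.
apply: measurable_funB.
  exact: (measurableT_comp (@measurable_coord R d i) measurable_snd).
apply: measurable_funD => //; apply: measurable_sum => j.
under eq_fun do rewrite !mxE.
apply: measurable_funM => //; apply: measurable_funD => //.
exact: (measurableT_comp (@measurable_coord R d j) measurable_fst).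
Qed.

Lemma measurable_opt_density : measurable_fun setT q.
Proof.
apply: measurable_funM.
  exact: (measurableT_comp (measurable_gauss_pdf m1 S1) measurable_fst).
apply: measurable_funM => //; apply: measurableT_comp => //; apply: measurable_funM => //.
exact: (measurableT_comp (@measurable_quad R d _) (measurable_affine X m2 m1)).
Qed.

(** Regression matrix and conditional covariance being proportional, the mixed term does not involve
    [A]: it is a multiple of the inner product, as in the squared distance. *)
Lemma quad_cond (u v : 'rV[R]_d) (A : 'M[R]_d) : posdef A ->
  quad (invmx (k *: A)) (v - u *m A) =
  k^-1 * (quad (invmx A) v - 2 * (v *m u^T) 0 0 + quad A u).
Proof.
move=> Ap; have Au := posdef_unitmx Ap; have [As _] := Ap.
rewrite invmx_scale ?gt_eqF // quadZ quad_subr; last by rewrite trmx_inv As.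
congr (_ * (_ - _ * _ + _)); rewrite ?/quad trmx_mul As mulmxA.
  by rewrite mulmxKV.
by rewrite mulmxK // mulmxA.
Qed.

Lemma ln_det_scale (A : 'M[R]_d) : posdef A -> ln (\det (k *: A)) = ln k *+ d + ln (\det A).
Proof.
by move=> /posdef_det_gt0 A0; rewrite detZ lnM ?posrE ?exprn_gt0 // lnXn.
Qed.

Lemma ln_opt_density x y : ln (q (x, y)) = - d%:R * ln (2 * pi)
  - 2^-1 * (ln (\det S1) + ln k *+ d + ln (\det X))
  - 2^-1 * (quad (invmx S1) ((x : 'rV_d) - m1) +
            k^-1 * (quad (invmx X) ((y : 'rV_d) - m2)
              - 2 * (((y : 'rV_d) - m2) *m ((x : 'rV_d) - m1)^T) 0 0
              + quad X ((x : 'rV_d) - m1))).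
Proof.
have kXp := posdefZ k0 Xp.
rewrite /opt_density lnM ?posrE ?gauss_pdf_gt0 // !ln_gauss_pdf //=.
have -> : y - (m2 + (x - m1) *m X) = (y - m2) - (x - m1) *m X by rewrite opprD addrA.
rewrite quad_cond // ln_det_scale //.
by field; rewrite gt_eqF.
Qed.

End quadratic_forms.

(** The same joint density, disintegrated from the second variable: the logarithms agree term by
    term thanks to [riccati_dual]. It gives the second marginal by the same argument as the
    first. *)
Lemma opt_density_sym (R : realType) d (m1 m2 : 'rV[R]_d) (S1 S2 X : 'M[R]_d) (k : R)
    (x y : Rd R d) :
  posdef S1 -> posdef S2 -> posdef X -> 0 < k -> X *m S1 *m X + k *: X = S2 ->
  opt_density m1 m2 S1 X k (x, y) =
  opt_density m2 m1 S2 (invmx (X + k *: invmx S1)) k (y, x).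
Proof.
move=> S1p S2p Xp k0 ric; have [Yp XY detXY] := riccati_dual S1p S2p Xp k0 ric.
have p1 : opt_density m1 m2 S1 X k (x, y) \is Num.pos by exact: opt_density_gt0.
have p2 : opt_density m2 m1 S2 (invmx (X + k *: invmx S1)) k (y, x) \is Num.pos.
  exact: opt_density_gt0.
apply: (ln_inj p1 p2).
rewrite (ln_opt_density _ _ S1p Xp k0) (ln_opt_density _ _ S2p Yp k0).
have lnE : ln (\det S1) + ln (\det X) =
    ln (\det S2) + ln (\det (invmx (X + k *: invmx S1))).
  by rewrite -!lnM ?posrE ?posdef_det_gt0 // detXY.
have -> : quad (invmx X) (y - m2) =
    quad (invmx (X + k *: invmx S1)) (y - m2) + k * quad (invmx S2) (y - m2).
  by rewrite XY quadD quadZ.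
rewrite invmxK quadD quadZ.
have -> : ((y - m2) *m (x - m1)^T) 0 0 = ((x - m1) *m (y - m2)^T) 0 0.
  by rewrite -trmx00 trmx_mul trmxK.
move: lnE; move: (ln (\det S1)) (ln (\det X)) (ln (\det S2)) (ln (\det (invmx _))).
move=> a b c e h; have -> : a = c + e - b by lra.
by field; rewrite gt_eqF.
Qed.

(** * Couplings *)

Lemma has_integral_comp d1 d2 (T1 : measurableType d1) (T2 : measurableType d2)
    (R : realType) (mu : {measure set T1 -> \bar R}) (nu : {measure set T2 -> \bar R})
    (phi : T1 -> T2) (f : T2 -> R) v : measurable_fun setT phi ->
  (forall A, measurable A -> mu (phi @^-1` A) = nu A) ->
  has_integral nu f v -> has_integral mu (f \o phi) v.
Proof.
move=> mphi numu fv; have mf := has_integral_measurable fv.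
have mEf : measurable_fun setT (EFin \o f) by exact/measurable_EFinP.
have intE (g : T2 -> \bar R) :
    (\int[pushforward mu phi]_y g y = \int[nu]_y g y)%E.
  by apply: (@eq_measure_integral _ _ _ _ nu
    (measure_function_pushforward__canonical__measure_function_Measure mu mphi)) => A mA _;
    exact: numu.
have fi : mu.-integrable setT (EFin \o (f \o phi)).
  apply/integrableP; split; first exact: measurableT_comp mEf mphi.
  have [/integrableP[_]] := fv; rewrite -intE ge0_integral_pushforward //.
  exact: measurableT_comp.
apply: has_integralI => //.
rewrite -(has_integralE fv) -intE integral_pushforward //.
Qed.

Section couplings.
Variables (R : realType) (d : nat).
Local Notation T := (Rd R d).
Variables (P Q : probability T R) (pi0 : probability (T * T)%type R).
Hypothesis PQ : coupling P Q pi0.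

Lemma has_integral_fst f v : has_integral P f v ->
  has_integral pi0 (fun z => f z.1) v.
Proof.
apply: (has_integral_comp (phi := fst)) => // A mA.
by rewrite -setXT; exact: (proj1 PQ A mA).
Qed.

Lemma has_integral_snd f v : has_integral Q f v ->
  has_integral pi0 (fun z => f z.2) v.
Proof.
apply: (has_integral_comp (phi := snd)) => // A mA.
by rewrite -setTX; exact: (proj2 PQ A mA).
Qed.

Hypotheses (P2 : finite_second_moments P) (Q2 : finite_second_moments Q).

(** By [(s - t)^2 <= 2 (s^2 + t^2)] the cost of every coupling is finite, so it can be subtracted
    from the objective. *)
Lemma cost_has_integral : exists c,
  has_integral pi0 (fun z : T * T => sqnorm ((z.1 : 'rV[R]_d) - z.2)) c.
Proof.
suff h i : has_integral pi0 (fun z : T * T => ((z.1 : 'rV[R]_d) - z.2) 0 i ^+ 2)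
    (\int[pi0]_(z in setT) ((z.1 : 'rV[R]_d) - z.2) 0 i ^+ 2).
  by eexists; exact: has_integral_sum h.
split => //.
have x2 : has_integral P (fun x : T => (x : 'rV_d) 0 i ^+ 2) _ := conj (P2 i) erefl.
have y2 : has_integral Q (fun x : T => (x : 'rV_d) 0 i ^+ 2) _ := conj (Q2 i) erefl.
have [xy _] := has_integralZ 2 (has_integralD (has_integral_fst x2) (has_integral_snd y2)).
apply: le_integrable xy => //.
  apply/measurable_EFinP; apply: measurable_funX; under eq_fun do rewrite !mxE.
  apply: measurable_funB.
    exact: (measurableT_comp (@measurable_coord R d i) measurable_fst).
  exact: (measurableT_comp (@measurable_coord R d i) measurable_snd).
move=> z _; rewrite !abse_EFin lee_fin (ger0_norm (sqr_ge0 _)) ger0_norm; last first.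
  by rewrite mulr_ge0 ?addr_ge0 ?sqr_ge0.
rewrite !mxE; move: ((z.1 : 'rV_d) 0 i) ((z.2 : 'rV_d) 0 i) => s t.
by have := sqr_ge0 (s + t); lra.
Qed.

Variables (X : 'M[R]_d) (k : R).
Local Notation m1 := (mean P).
Local Notation m2 := (mean Q).
Local Notation S1 := (cov P).
Local Notation S2 := (cov Q).
Hypotheses (S1p : posdef S1) (S2p : posdef S2) (Xp : posdef X) (k0 : 0 < k).
Hypothesis ric : X *m S1 *m X + k *: X = S2.

(** The right-hand side of the theorem, with [k] for [eps / 2] and [X] for [Xeps]. *)
Definition gelbrich_bound : R :=
  sqnorm (m1 - m2) + \tr S1 + \tr S2 - 2 * \tr (S1 *m X)
    - k * ln ((2 * pi * expR 1) ^+ (2 * d) * k ^+ d * \det (S1 *m X)).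

Lemma gelbrich_boundE : gelbrich_bound = sqnorm (m1 - m2) + \tr S1 + \tr S2 - 2 * \tr (S1 *m X)
  - k * (2 * d%:R * ln (2 * pi) + 2 * d%:R + ln k *+ d + ln (\det S1) + ln (\det X)).
Proof.
have pi0' : 0 < 2 * pi :> R by rewrite mulr_gt0 ?pi_gt0.
have [d1 d2] := (posdef_det_gt0 S1p, posdef_det_gt0 Xp).
have e0 : 0 < 2 * pi * expR 1 :> R by rewrite mulr_gt0 ?expR_gt0.
have le : ln (2 * pi * expR 1) = ln (2 * pi) + 1 :> R.
  by rewrite lnM ?posrE ?expR_gt0 // expRK.
have en := exprn_gt0 (2 * d) e0; have kn := exprn_gt0 d k0.
rewrite /gelbrich_bound det_mulmx [in LHS]lnM ?posrE ?mulr_gt0 // [in LHS]lnM ?posrE //.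
rewrite [in LHS]lnM ?posrE //.
rewrite (lnXn _ e0) (lnXn _ k0) le -[(_ + 1) *+ _]mulr_natl natrM.
by ring.
Qed.

(** The mixed terms cancel, so the integrand is a constant plus functions of one variable each, and
    the marginals determine its integral. *)
Lemma cost_ln_opt_density : has_integral pi0
  (fun z : T * T => sqnorm ((z.1 : 'rV[R]_d) - z.2) +
     2 * k * ln (opt_density m1 m2 S1 X k z)) gelbrich_bound.
Proof.
pose c0 := 2 * k * (- d%:R * ln (2 * pi) - 2^-1 * (ln (\det S1) + ln k *+ d + ln (\det X)))
  - sqnorm (m1 - m2).
have hx2 := has_integral_fst (moment_quad P2 1%:M m2).
have hy2 := has_integral_snd (moment_quad Q2 1%:M m1).
have hx1 := has_integral_fst (has_integralZ k (moment_quad P2 (invmx S1) m1)).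
have hxX := has_integral_fst (moment_quad P2 X m1).
have hyX := has_integral_snd (moment_quad Q2 (invmx X) m2).
apply: has_integral_ext (has_integralB (has_integralB (has_integralB (has_integralD
  (has_integralD (has_integral_cst pi0 c0) hx2) hy2) hx1) hxX) hyX) _ _.
  move=> [x y] /=; rewrite (ln_opt_density _ _ S1p Xp k0).
  (* Centring at the opposite means gives the mixed term the centred variables in which it occurs in
     [ln q]. *)
  have -> : sqnorm (x - y) = quad 1%:M (x - m2) + quad 1%:M (y - m1)
      - sqnorm (m1 - m2) - 2 * ((y - m2) *m (x - m1)^T) 0 0.
    rewrite !sqnormE /quad !mulmx1 !mxE mulr_sumr -!big_split /= -!sumrB.
    by apply: eq_bigr => i _; rewrite !mxE; ring.
  rewrite /c0; field; rewrite gt_eqF //.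
have q0 A : quad A (0 : 'rV[R]_d) = 0 by rewrite /quad !mul0mx mxE.
rewrite !subrr !q0 !addr0 !mul1mx mulVmx ?posdef_unitmx // mxtrace1.
rewrite (riccati_trace Xp ric) gelbrich_boundE -!sqnormE (mxtrace_mulC X).
have -> : sqnorm (m2 - m1) = sqnorm (m1 - m2).
  by rewrite /sqnorm; apply: eq_bigr => i _; rewrite !mxE -sqrrN opprB.
by rewrite /c0; field.
Qed.

End couplings.

(** * Marginals of a density given by disintegration *)

Section product_densities.
Variables (R : realType) (d : nat).
Local Notation T := (Rd R d).
Variables (L : {sigma_finite_measure set T -> \bar R}).
Variables (lam2 : {measure set (T * T)%type -> \bar R}).
Hypothesis lam2E : forall E, measurable E -> lam2 E = (L \x L)%E E.
Variables (f : T -> R) (g : T -> T -> R).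
Hypotheses (mf : measurable_fun setT f) (f0 : forall x, 0 <= f x).
Hypotheses (mg : forall x, measurable_fun setT (g x)) (g0 : forall x y, 0 <= g x y).
Hypothesis g1 : forall x, (\int[L]_y (g x y)%:E = 1)%E.
Local Open Scope ereal_scope.

Let inner (A : set T) x :
  \int[L]_y ((fun u => (f u)%:E) \_ A x * (g x y)%:E) = ((fun u => (f u)%:E) \_ A) x.
Proof.
have fA0 : 0 <= ((fun u => (f u)%:E) \_ A) x.
  by rewrite patchE; case: ifP => // _; rewrite lee_fin.
rewrite ge0_integralZl // ?g1 ?mule1 //.
- by apply/measurable_EFinP; exact: mg.
- by move=> y _; rewrite lee_fin.
Qed.

(** By Tonelli the second variable is integrated first, where [g x] contributes 1. *)
Lemma integral_prod_density_fst (A : set T) : measurable A ->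
  measurable_fun setT (fun z : T * T => f z.1 * g z.1 z.2)%R ->
  \int[lam2]_(z in A `*` setT) (f z.1 * g z.1 z.2)%:E = \int[L]_(x in A) (f x)%:E.
Proof.
move=> mA mfg; have mAT : measurable (A `*` [set: T]) by exact: measurableX.
rewrite (eq_measure_integral (L \x L)); last by move=> E mE _; exact: lam2E.
rewrite integral_mkcond [RHS]integral_mkcond.
have E z : ((fun z : T * T => (f z.1 * g z.1 z.2)%:E) \_ (A `*` setT)) z =
    ((fun u => (f u)%:E) \_ A) z.1 * (g z.1 z.2)%:E.
  rewrite !patchE; have -> : (z \in A `*` setT) = (z.1 \in A).
    by apply/idP/idP => /set_mem h; apply/mem_set; [case: h|split].
  by case: ifP => _; rewrite ?mul0e.
rewrite fubini_tonelli1.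
- apply: eq_integral => x _; rewrite /fubini_F -inner.
  by apply: eq_integral => y _; rewrite E.
- by apply/(measurable_restrictT _ mAT); apply: measurable_funTS; exact/measurable_EFinP.
- by move=> z; rewrite E patchE mule_ge0 ?lee_fin //; case: ifP; rewrite ?lee_fin.
Qed.

Lemma integral_prod_density_snd (A : set T) : measurable A ->
  measurable_fun setT (fun z : T * T => f z.2 * g z.2 z.1)%R ->
  \int[lam2]_(z in setT `*` A) (f z.2 * g z.2 z.1)%:E = \int[L]_(x in A) (f x)%:E.
Proof.
move=> mA mfg; have mAT : measurable ([set: T] `*` A) by exact: measurableX.
rewrite (eq_measure_integral (L \x L)); last by move=> E mE _; exact: lam2E.
rewrite integral_mkcond [RHS]integral_mkcond.
have E z : ((fun z : T * T => (f z.2 * g z.2 z.1)%:E) \_ (setT `*` A)) z =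
    ((fun u => (f u)%:E) \_ A) z.2 * (g z.2 z.1)%:E.
  rewrite !patchE; have -> : (z \in setT `*` A) = (z.2 \in A).
    by apply/idP/idP => /set_mem h; apply/mem_set; [case: h|split].
  by case: ifP => _; rewrite ?mul0e.
rewrite fubini_tonelli2.
- apply: eq_integral => y _; rewrite /fubini_G -inner.
  by apply: eq_integral => x _; rewrite E.
- by apply/(measurable_restrictT _ mAT); apply: measurable_funTS; exact/measurable_EFinP.
- by move=> z; rewrite E patchE mule_ge0 ?lee_fin //; case: ifP; rewrite ?lee_fin.
Qed.

End product_densities.

Lemma quadratic_slope_eq0 (R : realType) (t : R) : (forall s, 2 * s * t - 4 * s ^+ 2 <= 0) -> t = 0.
Proof.
(* The parabola in [s] peaks at [t / 4] with value [t^2 / 4]. *)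
move=> /(_ (t / 4)) h; have : t ^+ 2 <= 0 by lra.
by rewrite le_eqVlt ltNge sqr_ge0 orbF sqrf_eq0 => /eqP.
Qed.

(** * The optimal coupling and the equality case *)

Section optimal_coupling.
Variables (R : realType) (d : nat).
Local Notation T := (Rd R d).
Variables (lam : {measure set T -> \bar R}) (lam2 : {measure set (T * T)%type -> \bar R}).
Hypotheses (lamE : is_lebesgue lam) (lam2E : is_lebesgue2 lam2).
Variables (P Q : probability T R) (eps : R).
Hypotheses (P2 : finite_second_moments P) (Q2 : finite_second_moments Q).
Hypotheses (S1p : posdef (cov P)) (S2p : posdef (cov Q)) (eps0 : 0 < eps).
Local Notation m1 := (mean P).
Local Notation m2 := (mean Q).
Local Notation S1 := (cov P).
Local Notation S2 := (cov Q).
Local Notation k := (eps / 2).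
Local Notation X := (Xeps S1 S2 eps).
Local Notation q := (opt_density m1 m2 S1 X k).
Local Notation rhs := (gelbrich_bound P Q X k).

Let k0 : 0 < k. Proof. by rewrite divr_gt0. Qed.
Let Xp : posdef X. Proof. by have [] := Xeps_riccati S1p S2p eps0. Qed.
Let ric : X *m S1 *m X + k *: X = S2. Proof. by have [] := Xeps_riccati S1p S2p eps0. Qed.

(** The marginals are Gaussians with the moments of [P] and [Q], so [pi1] couples [P] and [Q] only
    when these are Gaussian; otherwise it serves as a reference measure. *)
Lemma optimal_coupling_ex : exists pi1 : probability (T * T)%type R, [/\
  forall E, measurable E -> pi1 E = (\int[lam2]_(z in E) (q z)%:E)%E,
  forall A : set T, measurable A ->
    pi1 (A `*` setT) = (\int[lam]_(x in A) (gauss_pdf m1 S1 x)%:E)%E &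
  forall B : set T, measurable B ->
    pi1 (setT `*` B) = (\int[lam]_(y in B) (gauss_pdf m2 S2 y)%:E)%E].
Proof.
have [L [LE _]] := gauss_lebesgue_ex R d.
have l2E := lebesgue2_prod LE lam2E.
have mq := measurable_opt_density m1 m2 S1 X k.
have kXp := posdefZ k0 Xp.
have fstE (A : set T) : measurable A -> (\int[lam2]_(z in A `*` setT) (q z)%:E =
    \int[lam]_(x in A) (gauss_pdf m1 S1 x)%:E)%E.
  move=> mA; rewrite (eq_measure_integral L (m1 := lam)); last first.
    by move=> E mE _; exact: (lebesgue_unique lamE LE).
  exact: (integral_prod_density_fst l2E
    (g := fun x y => gauss_pdf (m2 + ((x : 'rV_d) - m1) *m X) (k *: X) y)
    (fun x => ltW (gauss_pdf_gt0 m1 x S1p)) (fun x => measurable_gauss_pdf _ _)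
    (fun x y => ltW (gauss_pdf_gt0 _ y kXp)) (fun x => integral_gauss_pdf _ LE kXp) mA mq).
have [Yp _ _] := riccati_dual S1p S2p Xp k0 ric.
have sndE (A : set T) : measurable A -> (\int[lam2]_(z in setT `*` A) (q z)%:E =
    \int[lam]_(y in A) (gauss_pdf m2 S2 y)%:E)%E.
  move=> mA; rewrite (eq_measure_integral L (m1 := lam)); last first.
    by move=> E mE _; exact: (lebesgue_unique lamE LE).
  pose Y := invmx (X + k *: invmx S1).
  have qE z : q z = gauss_pdf m2 S2 z.2 *
      gauss_pdf (m1 + ((z.2 : 'rV_d) - m2) *m Y) (k *: Y) z.1.
    by case: z => x y; rewrite (opt_density_sym _ _ _ _ S1p S2p Xp k0 ric).
  have mq' := eq_measurable_fun _ (fun z _ => qE z) mq.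
  have kYp := posdefZ k0 Yp.
  rewrite (eq_integral _ _ (fun z _ => congr1 EFin (qE z))).
  exact: (integral_prod_density_snd l2E
    (g := fun y x => gauss_pdf (m1 + ((y : 'rV_d) - m2) *m Y) (k *: Y) x)
    (fun x => ltW (gauss_pdf_gt0 m2 x S2p)) (fun x => measurable_gauss_pdf _ _)
    (fun x y => ltW (gauss_pdf_gt0 _ y kYp)) (fun x => integral_gauss_pdf _ LE kYp) mA mq').
have q0 z : 0 <= q z by apply/ltW/opt_density_gt0.
have q1 : (\int[lam2]_z (q z)%:E = 1)%E.
  by rewrite -setXTT fstE // integral_gauss_pdf.
have [pi1 pi1E] := density_probability mq q0 q1.
by exists pi1; split => [E _|A mA|B mB]; rewrite pi1E ?fstE ?sndE.
Qed.

(* For s = 0 this is the inequality of the theorem; letting s vary forces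
   A = pi1 E when the two sides of the theorem agree. *)
Lemma W22eps_lower_bound (pi1 : probability (T * T)%type R) (E : set (T * T)) (A : \bar R) s :
  (forall E, measurable E -> pi1 E = (\int[lam2]_(z in E) (q z)%:E)%E) ->
  measurable E -> (forall pi0, coupling P Q pi0 -> pi0 E = A) ->
  ((rhs + eps * (2 * s * (fine A - fine (pi1 E)) - 4 * s ^+ 2))%:E <=
   W22eps lam2 eps P Q)%E.
Proof.
move=> pi1E mE EA; apply: le_ereal_inf_tmp => _ [pi0 /= cpl <-].
have [c hc] := cost_has_integral cpl P2 Q2.
have htot := cost_ln_opt_density cpl P2 Q2 S1p Xp k0 ric.
(* As [2 * k = eps], [ln q] is the total integrand minus the cost, divided by [eps]. *)
have hln : has_integral pi0 (fun z => ln (q z)) (eps^-1 * (rhs - c)).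
  apply: has_integral_ext (has_integralZ eps^-1 (has_integralB htot hc)) _ erefl => z.
  by field; rewrite gt_eqF.
rewrite /cost (has_integralE hc).
set w := eps^-1 * (rhs - c) + (2 * s * (fine A - fine (pi1 E)) - 4 * s ^+ 2).
have -> : rhs + eps * (2 * s * (fine A - fine (pi1 E)) - 4 * s ^+ 2) = c + eps * w.
  by rewrite /w; field; rewrite gt_eqF.
rewrite EFinD EFinM leeD2l // lee_pmul2l //.
apply: le_ereal_inf_tmp => _ [r [[mr [r0 rE]] ->]].
rewrite /w addrA -(EA _ cpl).
apply: (entropy_lower_bound s mr r0 (measurable_opt_density _ _ _ _ _) _ rE pi1E hln mE).
exact: opt_density_gt0.
Qed.

Lemma W22eps_ge : (rhs%:E <= W22eps lam2 eps P Q)%E.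
Proof.
have [pi1 [pi1E _ _]] := optimal_coupling_ex.
have := @W22eps_lower_bound pi1 set0 0%E 0 pi1E measurable0 (fun pi0 _ => measure0 pi0).
by rewrite !mulr0 mul0r expr0n /= mulr0 subrr mulr0 addr0.
Qed.

(** Under equality the correction in the lower bound is nonpositive for every [s], so its slope
    [A - pi1 E] at [s = 0] vanishes. The sets [E] in view are cylinders, on which all couplings
    agree. *)
Lemma W22eps_eq_marginal (pi1 : probability (T * T)%type R) (E : set (T * T)) (A : \bar R) :
  W22eps lam2 eps P Q = rhs%:E ->
  (forall E, measurable E -> pi1 E = (\int[lam2]_(z in E) (q z)%:E)%E) ->
  measurable E -> (forall pi0, coupling P Q pi0 -> pi0 E = A) -> A \is a fin_num ->
  A = pi1 E.
Proof.
move=> WE pi1E mE EA Afin.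
have pfin : pi1 E \is a fin_num by exact: fin_num_measure.
rewrite -(fineK Afin) -(fineK pfin); congr EFin; apply/eqP; rewrite -subr_eq0; apply/eqP.
apply: quadratic_slope_eq0 => s.
have := W22eps_lower_bound s pi1E mE EA.
by rewrite WE lee_fin gerDl pmulr_rle0.
Qed.

Lemma W22eps_eq_gaussian : W22eps lam2 eps P Q = rhs%:E ->
  gaussian lam P /\ gaussian lam Q.
Proof.
move=> WE; have [pi1 [pi1E pi1P pi1Q]] := optimal_coupling_ex.
split.
- exists m1, S1; split=> [|A mA]; first exact: S1p.
  rewrite -(pi1P A mA); apply: (W22eps_eq_marginal WE pi1E).
  + exact: measurableX.
  + by move=> pi0 [cP _]; exact: cP.
  + exact: fin_num_measure.
- exists m2, S2; split=> [|A mA]; first exact: S2p.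
  rewrite -(pi1Q A mA); apply: (W22eps_eq_marginal WE pi1E).
  + exact: measurableX.
  + by move=> pi0 [_ cQ]; exact: cQ.
  + exact: fin_num_measure.
Qed.

(** [gaussian] leaves the parameters free, whereas the marginals of [pi1] are written with means and
    covariances. *)
Lemma gaussian_mean_cov (P' : probability T R) : finite_second_moments P' -> gaussian lam P' ->
  forall A, measurable A ->
  P' A = (\int[lam]_(x in A) (gauss_pdf (mean P') (cov P') x)%:E)%E.
Proof.
move=> P'2 [m [S [Sp PE]]] A mA.
by rewrite (gaussian_mean lamE P'2 Sp PE) (gaussian_cov lamE P'2 Sp PE) PE.
Qed.

Lemma gaussian_W22eps_eq : gaussian lam P -> gaussian lam Q ->
  W22eps lam2 eps P Q = rhs%:E.
Proof.
move=> gP gQ; apply/eqP; rewrite eq_le W22eps_ge andbT.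
have [pi1 [pi1E pi1P pi1Q]] := optimal_coupling_ex.
have cpl : coupling P Q pi1.
  by split=> A mA; rewrite (pi1P, pi1Q) // -gaussian_mean_cov.
have [c hc] := cost_has_integral cpl P2 Q2.
have htot := cost_ln_opt_density cpl P2 Q2 S1p Xp k0 ric.
have hln : has_integral pi1 (fun z => ln (q z)) (eps^-1 * (rhs - c)).
  apply: has_integral_ext (has_integralZ eps^-1 (has_integralB htot hc)) _ erefl => z.
  by field; rewrite gt_eqF.
have mq := measurable_opt_density m1 m2 S1 X k.
have q0 z : 0 <= q z by apply/ltW/opt_density_gt0.
apply: (@le_trans _ _ (cost pi1 + eps%:E * entropy lam2 pi1)%E).
  by apply: ereal_inf_lbound; exists pi1.
have -> : rhs = c + eps * (eps^-1 * (rhs - c)) by field; rewrite gt_eqF.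
rewrite /cost (has_integralE hc) EFinD [in leRHS]EFinM leeD2l // lee_pmul2l //.
(* The entropy is an infimum over densities, so the density [q] bounds it by the integral of
   [q ln q], that is, of [ln q] under [pi1]. *)
apply: ereal_inf_lbound; exists q; split; first by split.
rewrite -(has_integralE (has_integral_density mq q0 pi1E hln)).
by apply: eq_integral => z _; rewrite mulrC.
Qed.

End optimal_coupling.

Unset Implicit Arguments.

Theorem theorem2 (R : realType) (d : nat)
  (lam : {measure set (Rd R d) -> \bar R})
  (lam2 : {measure set (Rd R d * Rd R d)%type -> \bar R})
  (P Q : probability (Rd R d) R) (eps : R) :
  is_lebesgue lam -> is_lebesgue2 lam2 ->
  finite_second_moments P -> finite_second_moments Q ->
  posdef (cov P) -> posdef (cov Q) -> 0 < eps ->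
  let mu1 := mean P in let mu2 := mean Q in
  let S1 := cov P in let S2 := cov Q in
  let X := Xeps S1 S2 eps in
  let rhs : R :=
    sqnorm (mu1 - mu2) + \tr S1 + \tr S2 - 2 * \tr (S1 *m X)
    - eps / 2 * ln ((2 * pi * expR 1) ^+ (2 * d) * (eps / 2) ^+ d
                    * \det (S1 *m X)) in
  (rhs%:E <= W22eps lam2 eps P Q)%E /\
  (W22eps lam2 eps P Q = rhs%:E <-> gaussian lam P /\ gaussian lam Q).
Proof.
move=> lamE lam2E P2 Q2 S1p S2p eps0 /=.
split; first exact: (W22eps_ge lamE).
split; first exact: W22eps_eq_gaussian.
by case; exact: gaussian_W22eps_eq.
Qed.
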